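(* Let $H$ be a compact quantum group with antipode $S$ and normal integral $\varphi$, and consider the inner product $\langle x,y\rangle=\varphi(S(y^\circ)x)$ given by the normal integral. Then the following properties are equivalent: (1) The compact quantum group $H$ is involutive, i.e. $S^2=\mathrm{id}$. (2) The positive antipode is trivial, i.e. $S_+=\mathrm{id}$. (3) The unitary antipode coincides with $S$, i.e. $U=S$. (4) The antipode $S$ has finite order. (5) The antipode $S$ is a normal operator, i.e. $S$ commutes with $S^*$. (6) The antipode $S$ is a selfadjoint operator. (7) The integral $\varphi:H\to\mathbb{C}$ is central, i.e. $\varphi(xy)=\varphi(yx)$ for all $x,y\in H$. (8) The Nakayama automorphism satisfies $\mathcal{N}=\mathrm{id}$.
   Context: Everything is over $\mathbb{C}$. A $\circ$-structure on a coalgebra is a conjugate linear involution $c\mapsto c^\circ$ with $\Delta(c^\circ)=\sum c_2^\circ\otimes c_1^\circ$. A $\circ$-Hopf algebra is a Hopf algebra $H$ with a $\circ$-structure on its coalgebra such that $(xy)^\circ=x^\circ y^\circ$. A unitary inner product on a right $H$-comodule $V$ (coaction $v\mapsto\sum v_0\otimes v_1$) is an inner product (linear in the first, conjugate linear in the second variable) with $\sum\langle u_0,v\rangle u_1=\sum\langle u,v_0\rangle v_1^\circ$ for all $u,v$. A compact quantum group is a $\circ$-Hopf algebra such that every right $H$-comodule admits a unitary inner product. Such an $H$ is cosemisimple (the direct sum of its simple subcoalgebras); the normal integral $\varphi:H\to\mathbb{C}$ is the projection onto the simple subcoalgebra $\mathbb{C}1\cong\mathbb{C}$ along the sum of the others,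 and $\langle x,y\rangle=\varphi(S(y^\circ)x)$ is an inner product on $H$. Adjoints ($S^*$ exists) and positivity refer to it; an operator $L$ is positive if it is selfadjoint and $\langle L(x),x\rangle>0$ for all $x\ne0$. The operator $S^2$ is positive, and the positive antipode $S_+$ is the unique positive automorphism of algebras and coalgebras of $H$ with $S_+^2=S^2$. The Nakayama automorphism $\mathcal{N}$ is the algebra automorphism of $H$ with $\varphi(xy)=\varphi(y\,\mathcal{N}(x))$ for all $x,y$; it is positive, and $\mathcal{P}$ denotes the unique positive algebra automorphism with $\mathcal{P}^2=\mathcal{N}$. The unitary antipode is $U=SS_+^{-1}\mathcal{P}^{-1}$, the unitary operator in the polar decomposition $S=U\mathcal{P}S_+$. *)

(* Defs.v *)
From HB Require Import structures.
From mathcomp Require Import all_boot all_order all_algebra.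
From mathcomp Require Import boolp classical_sets.

Set Implicit Arguments.
Unset Strict Implicit.
Unset Printing Implicit Defensive.

Import Order.TTheory GRing.Theory Num.Theory.
Local Open Scope quotient_scope.
Local Open Scope ring_scope.

Reserved Notation "u \ox v" (at level 40, left associativity).

Section TensorProduct.
Variables (K : comNzRingType) (U V : lmodType K).

Definition balanced (A : zmodType) (f : U -> V -> A) : Prop :=
  [/\ forall u1 u2 v, f (u1 + u2) v = f u1 v + f u2 v,
      forall u v1 v2, f u (v1 + v2) = f u v1 + f u v2
    & forall k u v, f (k *: u) v = f u (k *: v)].

Definition tsum (A : zmodType) (f : U -> V -> A) (s : seq (U * V)) : A :=
  \sum_(p <- s) f p.1 p.2.

(* The tensor product is the quotient of the finite formal sums of pairs that
   is universal for balanced maps into abelian groups (this makes K-bilinear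
   maps as well as maps conjugate linear in both variables factor through). *)
Definition tensor_equiv (s t : seq (U * V)) : bool :=
  `[< forall (A : zmodType) (f : U -> V -> A),
        balanced f -> tsum f s = tsum f t >].

Lemma tensor_equiv_refl : reflexive tensor_equiv.
Proof. by move=> s; apply/asboolP. Qed.

Lemma tensor_equiv_sym : symmetric tensor_equiv.
Proof.
by move=> s t; apply/asboolP/asboolP => H A f /H.
Qed.

Lemma tensor_equiv_trans : transitive tensor_equiv.
Proof.
move=> t s r /asboolP st /asboolP tr; apply/asboolP => A f bf.
by rewrite st // tr.
Qed.

Canonical tensor_equiv_rel :=
  EquivRel tensor_equiv tensor_equiv_refl tensor_equiv_sym tensor_equiv_trans.

Definition tensor := {eq_quot tensor_equiv_rel}.
HB.instance Definition _ := Choice.on tensor.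

Definition pure (u : U) (v : V) : tensor := \pi_tensor [:: (u, v)].

(* The map induced on the tensor product by f: for t = sum_i u_i \ox v_i,
   the value tlift f t is sum_i f u_i v_i whenever f is balanced. *)
Definition tlift (A : zmodType) (f : U -> V -> A) (t : tensor) : A :=
  tsum f (repr t).

Lemma tlift_pi (A : zmodType) (f : U -> V -> A) s :
  balanced f -> tlift f (\pi_tensor s) = tsum f s.
Proof.
move=> bf; have /eqP : repr (\pi_tensor s) = s %[mod tensor] by rewrite reprK.
by rewrite eqmodE => /asboolP; apply.
Qed.

Lemma tensor_ext (x y : tensor) :
  (forall (A : zmodType) (f : U -> V -> A),
      balanced f -> tlift f x = tlift f y) ->
  x = y.
Proof.
move=> H; rewrite -[x]reprK -[y]reprK; apply/eqP; rewrite eqmodE.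
by apply/asboolP.
Qed.

Definition tensor0 : tensor := \pi_tensor [::].
Definition tensor_add (x y : tensor) : tensor :=
  \pi_tensor (repr x ++ repr y).
Definition tensor_opp (x : tensor) : tensor :=
  \pi_tensor [seq (- p.1, p.2) | p <- repr x].
Definition tensor_scale (k : K) (x : tensor) : tensor :=
  \pi_tensor [seq (k *: p.1, p.2) | p <- repr x].

Section Lift.
Variables (A : zmodType) (f : U -> V -> A).
Hypothesis bf : balanced f.

Lemma tlift0 : tlift f tensor0 = 0.
Proof. by rewrite tlift_pi // /tsum big_nil. Qed.

Lemma tlift_add x y : tlift f (tensor_add x y) = tlift f x + tlift f y.
Proof. by rewrite tlift_pi // /tsum big_cat. Qed.

Lemma balancedN u v : f (- u) v = - f u v.
Proof.
have [fD _ _] := bf; apply/eqP; rewrite -addr_eq0 -fD addNr.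
by rewrite -(addrI (f 0 v)  (_ : f 0 v + f 0 v = f 0 v + 0)) // -fD !addr0.
Qed.

Lemma tlift_opp x : tlift f (tensor_opp x) = - tlift f x.
Proof.
rewrite tlift_pi // /tlift /tsum big_map /= -sumrN.
by apply: eq_bigr => p _; rewrite balancedN.
Qed.

Lemma balancedZ k : balanced (fun u v => f (k *: u) v).
Proof.
have [fDl fDr fZ] := bf; split=> [u1 u2 v|u v1 v2|l u v].
- by rewrite scalerDr fDl.
- exact: fDr.
- by rewrite scalerA mulrC -scalerA fZ.
Qed.

Lemma tlift_scale k x :
  tlift f (tensor_scale k x) = tlift (fun u v => f (k *: u) v) x.
Proof. by rewrite tlift_pi // /tlift /tsum big_map. Qed.

End Lift.

Lemma tensor_addA : associative tensor_add.
Proof. by move=> x y z; apply: tensor_ext => A f bf; rewrite !tlift_add ?addrA. Qed.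

Lemma tensor_addC : commutative tensor_add.
Proof. by move=> x y; apply: tensor_ext => A f bf; rewrite !tlift_add // addrC. Qed.

Lemma tensor_add0 : left_id tensor0 tensor_add.
Proof.
by move=> x; apply: tensor_ext => A f bf; rewrite tlift_add // tlift0 // add0r.
Qed.

Lemma tensor_addN : left_inverse tensor0 tensor_opp tensor_add.
Proof.
move=> x; apply: tensor_ext => A f bf.
by rewrite tlift_add // tlift_opp // tlift0 // addNr.
Qed.

HB.instance Definition _ := GRing.isZmodule.Build tensor
  tensor_addA tensor_addC tensor_add0 tensor_addN.

Lemma tensor_scaleA k l (x : tensor) :
  tensor_scale k (tensor_scale l x) = tensor_scale (k * l) x.
Proof.
apply: tensor_ext => A f bf.
rewrite !tlift_scale //; last exact: balancedZ.
by apply: eq_bigr => p _; rewrite scalerA.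
Qed.

Lemma tensor_scale1 : left_id 1 tensor_scale.
Proof.
move=> x; apply: tensor_ext => A f bf; rewrite tlift_scale //.
by apply: eq_bigr => p _; rewrite scale1r.
Qed.

Lemma tensor_scaleDr : right_distributive tensor_scale +%R.
Proof.
move=> k x y; apply: tensor_ext => A f bf.
by rewrite [in RHS]tlift_add // !tlift_scale // tlift_add //; exact: balancedZ.
Qed.

Lemma tensor_scaleDl x : {morph tensor_scale^~ x : k l / k + l}.
Proof.
move=> k l; apply: tensor_ext => A f bf.
rewrite [in RHS]tlift_add // !tlift_scale // /tlift /tsum -big_split /=.
by apply: eq_bigr => p _; rewrite scalerDl; case: bf => ->.
Qed.

HB.instance Definition _ := GRing.Zmodule_isLmodule.Build K tensor
  tensor_scaleA tensor_scale1 tensor_scaleDr tensor_scaleDl.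

Lemma tlift_pure (A : zmodType) (f : U -> V -> A) u v :
  balanced f -> tlift f (pure u v) = f u v.
Proof. by move=> bf; rewrite tlift_pi // /tsum big_seq1. Qed.

Lemma tliftD (A : zmodType) (f : U -> V -> A) :
  balanced f -> {morph tlift f : x y / x + y}.
Proof. by move=> bf x y; exact: tlift_add. Qed.

Lemma tliftZ (A : zmodType) (f : U -> V -> A) k x :
  balanced f -> tlift f (k *: x) = tlift (fun u v => f (k *: u) v) x.
Proof. by move=> bf; exact: tlift_scale. Qed.

Lemma balanced_pure : balanced pure.
Proof.
split=> *; apply: tensor_ext => A f bf; rewrite ?tliftD // !tlift_pure //;
  by case: bf.
Qed.

Lemma pureZl k u v : pure (k *: u) v = k *: pure u v.
Proof.
apply: tensor_ext => A f bf; rewrite tliftZ // !tlift_pure //.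
exact: balancedZ.
Qed.

Lemma pureZr k u v : pure u (k *: v) = k *: pure u v.
Proof. by rewrite -pureZl; have [_ _ ->] := balanced_pure. Qed.

Lemma tensor_sum (x : tensor) :
  exists s : seq (U * V), x = \sum_(p <- s) pure p.1 p.2.
Proof.
exists (repr x); apply: tensor_ext => A f bf; rewrite /tlift {1}/tsum.
elim: (repr x) => [|p s IHs].
  by rewrite !big_nil -/(tlift f 0) tlift0.
by rewrite !big_cons -/(tlift f _) tliftD // tlift_pure // IHs.
Qed.

End TensorProduct.

Notation "u \ox v" := (pure u v) : ring_scope.

HB.mixin Record isCoalgebra (K : comNzRingType) C of GRing.Lmodule K C := {
  comul : C -> tensor C C;
  counit : C -> K;
  comul_is_linear : linear comul;
  counit_is_linear : scalar counit;
  comulA : forall c : C,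
    tlift (fun c1 c2 => tlift (fun c11 c12 => c11 \ox (c12 \ox c2)) (comul c1))
      (comul c) =
    tlift (fun c1 c2 => c1 \ox comul c2) (comul c);
  counitl : forall c : C, tlift (fun c1 c2 => counit c1 *: c2) (comul c) = c;
  counitr : forall c : C, tlift (fun c1 c2 => counit c2 *: c1) (comul c) = c
}.

#[short(type="coalgType")]
HB.structure Definition Coalgebra (K : comNzRingType) :=
  {C of isCoalgebra K C & GRing.Lmodule K C}.

HB.instance Definition _ (K : comNzRingType) (C : coalgType K) :=
  GRing.isLinear.Build K C (tensor C C) _ (@comul K C) comul_is_linear.
HB.instance Definition _ (K : comNzRingType) (C : coalgType K) :=
  GRing.isLinear.Build K C K _ (@counit K C) counit_is_linear.

HB.mixin Record Coalgebra_isBialgebra (K : comNzRingType) H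
    of Coalgebra K H & GRing.Algebra K H := {
  comul1 : comul (1 : H) = 1 \ox 1;
  comulM : forall x y : H,
    comul (x * y) =
    tlift (fun x1 x2 => tlift (fun y1 y2 => (x1 * y1) \ox (x2 * y2)) (comul y))
      (comul x);
  counit1 : counit (1 : H) = 1;
  counitM : forall x y : H, counit (x * y) = counit x * counit y
}.

#[short(type="bialgType")]
HB.structure Definition Bialgebra (K : comNzRingType) :=
  {H of Coalgebra_isBialgebra K H & Coalgebra K H & GRing.Algebra K H}.

HB.mixin Record Bialgebra_isHopf (K : comNzRingType) H of Bialgebra K H := {
  antipode : H -> H;
  antipode_is_linear : linear antipode;
  antipodel : forall x : H,
    tlift (fun x1 x2 => antipode x1 * x2) (comul x) = (counit x)%:A;
  antipoder : forall x : H,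
    tlift (fun x1 x2 => x1 * antipode x2) (comul x) = (counit x)%:A
}.

#[short(type="hopfType")]
HB.structure Definition Hopf (K : comNzRingType) :=
  {H of Bialgebra_isHopf K H & Bialgebra K H}.

HB.instance Definition _ (K : comNzRingType) (H : hopfType K) :=
  GRing.isLinear.Build K H H _ (@antipode K H) antipode_is_linear.

HB.mixin Record Coalgebra_isCirc (K : numClosedFieldType) C
    of Coalgebra K C := {
  circ : C -> C;
  circ_is_linear : linear_for (Num.conj \; *:%R) circ;
  circK : involutive circ;
  comul_circ : forall c : C,
    comul (circ c) = tlift (fun c1 c2 => circ c2 \ox circ c1) (comul c)
}.

#[short(type="circCoalgType")]
HB.structure Definition CircCoalgebra (K : numClosedFieldType) :=
  {C of Coalgebra_isCirc K C & Coalgebra K C}.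

HB.instance Definition _ (K : numClosedFieldType) (C : circCoalgType K) :=
  GRing.isLinear.Build K C C _ (@circ K C) circ_is_linear.

HB.mixin Record CircCoalgebra_isCircHopf (K : numClosedFieldType) H
    of CircCoalgebra K H & Hopf K H := {
  circM : forall x y : H, circ (x * y) = circ x * circ y
}.

#[short(type="circHopfType")]
HB.structure Definition CircHopf (K : numClosedFieldType) :=
  {H of CircCoalgebra_isCircHopf K H & CircCoalgebra K H & Hopf K H}.

Record comodule (K : comNzRingType) (H : coalgType K) (V : lmodType K) := {
  coact : {linear V -> tensor V H};
  coactA : forall v : V,
    tlift (fun v0 v1 => tlift (fun v00 v01 => v00 \ox (v01 \ox v1)) (coact v0))
      (coact v) =
    tlift (fun v0 v1 => v0 \ox comul v1) (coact v);
  coact_counit : forall v : V,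
    tlift (fun v0 v1 => counit v1 *: v0) (coact v) = v
}.

Definition unitary_dot (K : numClosedFieldType) (H : circHopfType K)
    (V : lmodType K) (rho : comodule H V) (dot : {dot V for Num.conj}) : Prop :=
  forall u v : V,
    tlift (fun u0 u1 => dot u0 v *: u1) (coact rho u) =
    tlift (fun v0 v1 => dot u v0 *: circ v1) (coact rho v).

Definition compact_quantum_group (K : numClosedFieldType)
    (H : circHopfType K) : Prop :=
  forall (V : lmodType K) (rho : comodule H V),
    exists dot : {dot V for Num.conj}, unitary_dot rho dot.

Section SimpleSubcoalgebras.
Local Open Scope classical_set_scope.
Variables (K : fieldType) (C : coalgType K).

Definition subcoalgebra (D : set C) : Prop :=
  [/\ D 0, forall (k : K) x y, D x -> D y -> D (k *: x + y)
    & forall c, D c -> exists2 s : seq (C * C),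
        (forall p, p \in s -> D p.1 /\ D p.2)
        & comul c = \sum_(p <- s) p.1 \ox p.2].

Definition simple_subcoalgebra (D : set C) : Prop :=
  [/\ subcoalgebra D, D <> [set 0]
    & forall E, subcoalgebra E -> E `<=` D -> E = [set 0] \/ E = D].

End SimpleSubcoalgebras.

(* The projection onto K1, identified with K through k |-> k%:A, along the sum
   of the other simple subcoalgebras. *)
Definition normal_integral (K : fieldType) (H : hopfType K)
    (phi : {scalar H}) : Prop :=
  phi 1 = 1 /\
  forall D : set H, simple_subcoalgebra D -> D <> range (fun k : K => k%:A) ->
    forall x, D x -> phi x = 0.

Definition integral_dot (K : numClosedFieldType) (H : circHopfType K)
  (phi : {scalar H}) (x y : H) : K := phi (antipode (circ y) * x).

Section Operators.
Variables (K : numClosedFieldType) (H : lmodType K) (dot : H -> H -> K).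

Definition adjoint (L M : H -> H) : Prop :=
  forall x y, dot (L x) y = dot x (M y).

Definition selfadjoint (L : H -> H) : Prop := adjoint L L.

Definition normal_operator (L : H -> H) : Prop :=
  exists2 M : H -> H, adjoint L M & L \o M =1 M \o L.

Definition positive_operator (L : H -> H) : Prop :=
  selfadjoint L /\ forall x, x != 0 -> 0 < dot (L x) x.

End Operators.

Record alg_automorphism (K : comNzRingType) (H : algType K) := {
  aut :> {lrmorphism H -> H};
  aut_inv : H -> H;
  autK : cancel aut aut_inv;
  aut_invK : cancel aut_inv aut
}.

Definition coalg_morphism (K : comNzRingType) (C D : coalgType K)
    (f : {linear C -> D}) : Prop :=
  (forall c, comul (f c) = tlift (fun c1 c2 => f c1 \ox f c2) (comul c)) /\
  (forall c, counit (f c) = counit c).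

(* S_+, N and P are unique objects with given properties; the three predicates
   below state that the given automorphism is the one so determined. *)
Definition positive_antipode (K : numClosedFieldType) (H : circHopfType K)
    (phi : {scalar H}) (Sp : alg_automorphism H) : Prop :=
  [/\ coalg_morphism Sp, positive_operator (integral_dot phi) Sp
    & Sp \o Sp =1 antipode \o antipode].

Definition nakayama (K : comNzRingType) (H : algType K)
    (phi : {scalar H}) (N : alg_automorphism H) : Prop :=
  forall x y, phi (x * y) = phi (y * N x).

Definition positive_sqrt (K : numClosedFieldType) (H : circHopfType K)
    (phi : {scalar H}) (N P : alg_automorphism H) : Prop :=
  positive_operator (integral_dot phi) P /\ P \o P =1 N.

Definition unitary_antipode (K : comNzRingType) (H : hopfType K)
    (Sp P : alg_automorphism H) : H -> H :=
  antipode \o aut_inv Sp \o aut_inv P.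

Definition finite_order (T : Type) (f : T -> T) : Prop :=
  exists2 n : nat, (0 < n)%N & iter n f =1 id.

(* Main.v *)
(* Write [x1, x2] for the legs of the coproduct, [°] for [circ] and
   [<x, y> = phi (S y° * x)]. Compactness gives a positive definite form [a] on
   [H] with [a(u1, v) u2 = a(u, v1) v2°]. Twisting it by [S^-1] and multiplying
   the two forms along the coproduct gives a positive definite form [d] for
   which orthogonal complements of subcoalgebras are subcoalgebras. Hence
   finite-dimensional subcoalgebras split into simple ones, and [phi], which is
   only prescribed on these, is the two-sided invariant [a(x, 1) / a(1, 1)].

   The form [<,>] has the same invariance as [d], so its eigenspaces relative to
   [d] are subcoalgebras; [a(u, v) = a(u1, v1) <u2, v2>] forces the eigenvalues
   to be positive, so [<,>] is positive definite. Consequently a positive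
   operator of finite order is the identity.

   Centrality of [phi] is equivalent to [N = id], because [phi] is nondegenerate,
   and to [S] being selfadjoint, because [<S x, y> = phi (x y°)] and
   [<x, S y> = phi (y° x)]. If [S^2 = id], evaluating
   [<u1, v1> phi (u2 S(v2°))] by invariance on the right and on the left gives
   [phi (S(v°) u) = phi (u S(v°))]; conversely centrality gives [S^2 = id] by
   [phi (x1 y) x2 = phi (x y1) S(y2)]. If [U = S], then [P S_+ = id], whence
   [N S^2 = id] and [S^4 = id]; if [S] is normal, then [N^2 = id]. *)
Require Import Defs.
From mathcomp Require Import all_boot all_order all_algebra.
From mathcomp Require Import boolp classical_sets.
From mathcomp Require Import reals complex.

Set Implicit Arguments.
Unset Strict Implicit.
Unset Printing Implicit Defensive.

Import Order.TTheory GRing.Theory Num.Theory.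
Local Open Scope ring_scope.

(** * Tensors and Sweedler sums *)

Section Tensors.
Variables (K : comNzRingType) (U V : lmodType K).

Lemma tlift_sum (A : zmodType) (f : U -> V -> A) I (r : seq I) P F :
  balanced f ->
  tlift f (\sum_(i <- r | P i) F i) = \sum_(i <- r | P i) tlift f (F i).
Proof.
move=> bf; apply: (big_morph _ (tliftD bf)); exact: tlift0.
Qed.

Lemma tlift_tlift (A : zmodType) (U' V' : lmodType K) (f : U -> V -> A)
    (g : U' -> V' -> tensor U V) t : balanced f ->
  tlift f (tlift g t) = \sum_(p <- repr t) tlift f (g p.1 p.2).
Proof. exact: tlift_sum. Qed.

Lemma tensor_seq (t : tensor U V) : t = \sum_(p <- repr t) p.1 \ox p.2.
Proof.
rewrite -[LHS]reprK; apply: tensor_ext => A f bf.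
rewrite tlift_pi // tlift_sum //; apply: eq_bigr => p _.
by rewrite tlift_pure.
Qed.

Lemma tensor_ind (P : tensor U V -> Prop) :
  P 0 -> (forall u v, P (u \ox v)) -> (forall x y, P x -> P y -> P (x + y)) ->
  forall t, P t.
Proof.
move=> P0 Pp PD t; rewrite (tensor_seq t).
by apply: (big_ind P) => // p _; exact: Pp.
Qed.

(** [repr] picks an arbitrary representative; balancedness of [f] makes the sum independent of that
    choice, so any explicit decomposition may replace it. *)
Lemma tlift_seq (A : zmodType) (f : U -> V -> A) (s : seq (U * V)) t :
  balanced f -> t = \sum_(p <- s) p.1 \ox p.2 ->
  \sum_(p <- repr t) f p.1 p.2 = \sum_(p <- s) f p.1 p.2.
Proof.
move=> bf ->; rewrite -/(tsum f _) -/(tlift f _) tlift_sum //.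
by apply: eq_bigr => p _; rewrite tlift_pure.
Qed.

Lemma pure0l (v : V) : (0 : U) \ox v = 0.
Proof. by rewrite -[0 in LHS](scale0r 0) pureZl scale0r. Qed.

Lemma pure0r (u : U) : u \ox (0 : V) = 0.
Proof. by rewrite -[0 in LHS](scale0r 0) pureZr scale0r. Qed.

Lemma pure_suml I (r : seq I) (F : I -> U) (v : V) :
  (\sum_(i <- r) F i) \ox v = \sum_(i <- r) F i \ox v.
Proof.
elim: r => [|i r IHr]; first by rewrite !big_nil pure0l.
by rewrite !big_cons -IHr; have [-> _ _] := @balanced_pure K U V.
Qed.

Lemma pure_sumr I (r : seq I) (F : I -> V) (u : U) :
  u \ox (\sum_(i <- r) F i) = \sum_(i <- r) u \ox F i.
Proof.
elim: r => [|i r IHr]; first by rewrite !big_nil pure0r.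
by rewrite !big_cons -IHr; have [_ -> _] := @balanced_pure K U V.
Qed.

End Tensors.

(** Sums over [sw x] are Sweedler sums: [\sum_(p <- sw x) f p.1 p.2] is convertible to
    [tlift f (comul x)]. *)
Notation sw x := (repr (comul x)).

(** Balancedness in each adjacent pair of arguments is what a lift to the triple tensor product
    requires. *)
Definition balanced3 (K : comNzRingType) (U V W : lmodType K) (A : zmodType)
    (g : U -> V -> W -> A) : Prop :=
  (forall w, balanced (fun u v => g u v w)) /\ (forall u, balanced (g u)).

Section Sweedler.
Variables (K : comNzRingType) (C : coalgType K).
Implicit Types (x y : C).

Lemma sw_eq (A : zmodType) (f : C -> C -> A) (s : seq (C * C)) x :
  balanced f -> comul x = \sum_(p <- s) p.1 \ox p.2 ->
  \sum_(p <- sw x) f p.1 p.2 = \sum_(p <- s) f p.1 p.2.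
Proof. exact: tlift_seq. Qed.

Lemma swD (A : zmodType) (f : C -> C -> A) x y : balanced f ->
  \sum_(p <- sw (x + y)) f p.1 p.2 =
  \sum_(p <- sw x) f p.1 p.2 + \sum_(p <- sw y) f p.1 p.2.
Proof. by move=> bf; rewrite linearD; exact: tliftD. Qed.

Lemma swZ (A : zmodType) (f : C -> C -> A) k x : balanced f ->
  \sum_(p <- sw (k *: x)) f p.1 p.2 = \sum_(p <- sw x) f (k *: p.1) p.2.
Proof. by move=> bf; rewrite linearZ; exact: tliftZ. Qed.

Lemma balanced3_swr (A : zmodType) (g : C -> C -> C -> A) :
  balanced3 g -> balanced (fun a u => \sum_(p <- sw u) g a p.1 p.2).
Proof.
move=> [g12 g23]; split=> [u1 u2 v|u v1 v2|k u v].
- by rewrite -big_split /=; apply: eq_bigr => p _; have [-> _ _] := g12 p.2.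
- exact: (swD _ _ (g23 u)).
- rewrite (@swZ _ (g u)) //; apply: eq_bigr => p _.
  by have [_ _ ->] := g12 p.2.
Qed.

(** Lifting [g] in its last two arguments and then in the first gives a map on [C \ox (C \ox C)],
    which is applied to both sides of [comulA]. *)
Lemma sw_coassoc (A : zmodType) (g : C -> C -> C -> A) x : balanced3 g ->
  \sum_(p <- sw x) \sum_(q <- sw p.1) g q.1 q.2 p.2 =
  \sum_(p <- sw x) \sum_(q <- sw p.2) g p.1 q.1 q.2.
Proof.
move=> [g12 g23].
have bG : balanced (fun a (t : tensor C C) => tlift (g a) t).
  split=> [u1 u2 v|u v1 v2|k u v].
  - rewrite /tlift /tsum -big_split /=; apply: eq_bigr => p _.
    by have [-> _ _] := g12 p.2.
  - by rewrite tliftD.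
  - rewrite tliftZ // /tlift /tsum; apply: eq_bigr => p _.
    by have [_ _ ->] := g12 p.2.
have := congr1 (tlift (fun a t => tlift (g a) t)) (comulA x).
rewrite !tlift_tlift // => E.
transitivity (\sum_(p <- sw x) tlift (fun a t => tlift (g a) t)
   (tlift (fun c11 c12 => c11 \ox (c12 \ox p.2)) (comul p.1))).
  apply: eq_bigr => p _; rewrite tlift_tlift //.
  by apply: eq_bigr => q _; rewrite !tlift_pure.
by rewrite E; apply: eq_bigr => p _; rewrite tlift_pure.
Qed.

Lemma sw_counitl x : \sum_(p <- sw x) counit p.1 *: p.2 = x.
Proof. exact: counitl. Qed.

Lemma sw_counitr x : \sum_(p <- sw x) counit p.2 *: p.1 = x.
Proof. exact: counitr. Qed.

Lemma sw_inj x : comul x = 0 -> x = 0.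
Proof.
have bf : balanced (fun a b : C => counit a *: b).
  split=> [u1 u2 v|u v1 v2|k u v].
  - by rewrite linearD scalerDl.
  - by rewrite scalerDr.
  - by rewrite linearZ scalerA mulrC.
by move=> x0; rewrite -(counitl x) x0 tlift0.
Qed.

End Sweedler.

Ltac bal_split := repeat match goal with
  | |- balanced3 _ => split
  | |- balanced _ => split
  | |- forall _, _ => intro
  end; cbv beta.

Ltac bal := bal_split;
  rewrite ?(linearD, mulrDl, mulrDr, scalerDl, scalerDr) //=;
  rewrite ?(linearZ, =^~ scalerAl, =^~ scalerAr, scalerA) //=;
  rewrite ?scalerA //=; rewrite ?(mulrA, mulrAC) //; try by rewrite mulrC.

(** * The antipode *)

Section HopfAlgebra.
Variables (K : comNzRingType) (H : hopfType K).
Implicit Types (x y : H).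
Local Notation S := (@antipode K H).

Lemma sw_mul (A : zmodType) (f : H -> H -> A) x y : balanced f ->
  \sum_(r <- sw (x * y)) f r.1 r.2 =
  \sum_(p <- sw x) \sum_(q <- sw y) f (p.1 * q.1) (p.2 * q.2).
Proof.
move=> bf; have := congr1 (tlift f) (comulM x y).
rewrite tlift_tlift // => E; rewrite [LHS]E; apply: eq_bigr => p _.
rewrite tlift_tlift //; by apply: eq_bigr => q _; rewrite tlift_pure.
Qed.

Lemma sw1 (A : zmodType) (f : H -> H -> A) : balanced f ->
  \sum_(r <- sw (1 : H)) f r.1 r.2 = f 1 1.
Proof.
by move=> bf; rewrite -/(tsum f _) -/(tlift f _) comul1 tlift_pure.
Qed.

Lemma sw_antipodel x : \sum_(p <- sw x) S p.1 * p.2 = (counit x)%:A.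
Proof. exact: antipodel. Qed.

Lemma sw_antipoder x : \sum_(p <- sw x) p.1 * S p.2 = (counit x)%:A.
Proof. exact: antipoder. Qed.

Lemma antipode1 : S 1 = 1.
Proof.
have := sw_antipodel 1; rewrite (sw1 (f := fun a b => S a * b)); last by bal.
by rewrite mulr1 counit1 scale1r.
Qed.

(** Both sides are contractions of the sum of [S (x1 y1) (x2 y2) (S y3 S x3)]: cancelling legs 2 and
    3 leaves [S (x y)], cancelling legs 1 and 2 leaves [S y S x]. *)
Lemma antipodeM x y : S (x * y) = S y * S x.
Proof.
pose G a1 a2 a3 b1 b2 b3 := S (a1 * b1) * (a2 * b2) * (S b3 * S a3).
transitivity (\sum_(p <- sw x) \sum_(p' <- sw p.2) \sum_(q <- sw y)
   \sum_(q' <- sw q.2) G p.1 p'.1 p'.2 q.1 q'.1 q'.2).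
  rewrite -[in LHS](sw_counitr x) mulr_suml linear_sum /=.
  apply: eq_bigr => p _; rewrite exchange_big /=.
  rewrite -scalerAl linearZ /= -[in LHS](sw_counitr y) mulr_sumr.
  rewrite linear_sum scaler_sumr /=; apply: eq_bigr => q _.
  transitivity (S (p.1 * q.1) * \sum_(p' <- sw p.2)
     p'.1 * (\sum_(q' <- sw q.2) q'.1 * S q'.2) * S p'.2).
    rewrite -scalerAr linearZ /=.
    under [in RHS]eq_bigr do rewrite sw_antipoder -scalerAr mulr1 -scalerAl.
    by rewrite -scaler_sumr sw_antipoder -!scalerAr mulr1 !scalerA mulrC.
  rewrite mulr_sumr; apply: eq_bigr => p' _.
  rewrite mulr_sumr mulr_suml mulr_sumr; apply: eq_bigr => q' _.
  by rewrite /G !mulrA.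
transitivity (\sum_(p <- sw x) \sum_(p' <- sw p.2) \sum_(q <- sw y)
   \sum_(q' <- sw q.1) G p.1 p'.1 p'.2 q'.1 q'.2 q.2).
  apply: eq_bigr => p _; apply: eq_bigr => p' _; apply/esym.
  by apply: (sw_coassoc (g := G p.1 p'.1 p'.2)); rewrite /G; bal.
rewrite -(@sw_coassoc _ _ _ (fun a1 a2 a3 => \sum_(q <- sw y)
   \sum_(q' <- sw q.1) G a1 a2 a3 q'.1 q'.2 q.2)); last first.
  rewrite /G; split=> w; split=> [u1 u2 v|u v1 v2|k u v];
   rewrite -?big_split /=; apply: eq_bigr => q _;
   rewrite -?big_split /=; apply: eq_bigr => q' _; bal.
rewrite -[in RHS](sw_counitl x) linear_sum mulr_sumr /=.
apply: eq_bigr => p _; rewrite exchange_big /=.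
rewrite -[in RHS](sw_counitl y) linear_sum mulr_suml /=.
apply: eq_bigr => q _.
transitivity ((\sum_(r <- sw (p.1 * q.1)) S r.1 * r.2) * (S q.2 * S p.2)).
  rewrite (sw_mul (f := fun a b => S a * b)); last by bal.
  rewrite mulr_suml; apply: eq_bigr => p' _.
  by rewrite mulr_suml; apply: eq_bigr.
rewrite sw_antipodel counitM -scalerAl mul1r !linearZ /= -scalerAl -scalerAr.
by rewrite scalerA mulrC.
Qed.

Lemma counit_antipode x : counit (S x) = counit x.
Proof.
have := congr1 counit (sw_antipodel x).
rewrite linear_sum linearZ /= counit1 mulr1 => <-.
rewrite -[in LHS](sw_counitr x) !linear_sum /=; apply: eq_bigr => p _.
by rewrite counitM !linearZ /= mulrC.
Qed.

Definition tmul (s t : tensor H H) : tensor H H :=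
  tlift (fun x1 x2 => tlift (fun y1 y2 => (x1 * y1) \ox (x2 * y2)) t) s.

Lemma tmulE s t : tmul s t =
  \sum_(p <- repr s) tlift (fun y1 y2 => (p.1 * y1) \ox (p.2 * y2)) t.
Proof. by []. Qed.

Lemma pureDl (u1 u2 v : H) : (u1 + u2) \ox v = u1 \ox v + u2 \ox v.
Proof. by have [-> _ _] := @balanced_pure K H H. Qed.

Lemma pureDr (u v1 v2 : H) : u \ox (v1 + v2) = u \ox v1 + u \ox v2.
Proof. by have [_ -> _] := @balanced_pure K H H. Qed.

Lemma tmul_pure_balanced (a b : H) :
  balanced (fun y1 y2 => (a * y1) \ox (b * y2)).
Proof.
split=> *; rewrite ?mulrDr ?pureDl ?pureDr //.
by rewrite -!scalerAr pureZl pureZr.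
Qed.

Lemma tmul_balanced (t : tensor H H) : balanced (fun x1 x2 =>
  tlift (fun y1 y2 => (x1 * y1) \ox (x2 * y2)) t).
Proof.
split=> [u1 u2 v|u v1 v2|k u v]; rewrite /tlift /tsum -?big_split /=;
  apply: eq_bigr => q _; rewrite ?mulrDl ?pureDl ?pureDr //.
by rewrite -!scalerAl pureZl pureZr.
Qed.

Lemma tmulDl s1 s2 t : tmul (s1 + s2) t = tmul s1 t + tmul s2 t.
Proof. by rewrite /tmul tliftD //; exact: tmul_balanced. Qed.

Lemma tmulDr s t1 t2 : tmul s (t1 + t2) = tmul s t1 + tmul s t2.
Proof.
rewrite !tmulE -big_split; apply: eq_bigr => p _ /=.
by rewrite tliftD //; exact: tmul_pure_balanced.
Qed.

Lemma tmulZl k s t : tmul (k *: s) t = k *: tmul s t.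
Proof.
rewrite /tmul tliftZ; last exact: tmul_balanced.
rewrite /tlift /tsum scaler_sumr; apply: eq_bigr => p _.
rewrite scaler_sumr; apply: eq_bigr => q _.
by rewrite -scalerAl pureZl.
Qed.

Lemma tmulZr k s t : tmul s (k *: t) = k *: tmul s t.
Proof.
rewrite !tmulE scaler_sumr; apply: eq_bigr => p _.
rewrite tliftZ; last exact: tmul_pure_balanced.
rewrite /tlift /tsum scaler_sumr; apply: eq_bigr => q _.
by rewrite -scalerAr pureZl.
Qed.

Lemma tmul_pure (a b c d : H) : tmul (a \ox b) (c \ox d) = (a * c) \ox (b * d).
Proof.
rewrite /tmul tlift_pure; last exact: tmul_balanced.
by rewrite tlift_pure //; exact: tmul_pure_balanced.
Qed.

Lemma tmul_suml I (r : seq I) F t :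
  tmul (\sum_(i <- r) F i) t = \sum_(i <- r) tmul (F i) t.
Proof. by rewrite /tmul tlift_sum //; exact: tmul_balanced. Qed.

Lemma tmul_sumr I (r : seq I) F s :
  tmul s (\sum_(i <- r) F i) = \sum_(i <- r) tmul s (F i).
Proof.
elim: r => [|i r IHr]; last by rewrite !big_cons tmulDr IHr.
by rewrite !big_nil; have := tmulZr 0 s 0; rewrite !scale0r.
Qed.

Lemma comul_tmul x y : comul (x * y) = tmul (comul x) (comul y).
Proof. exact: comulM. Qed.

Local Opaque tmul.

Lemma tmul0l t : tmul 0 t = 0.
Proof. by have := tmulZl 0 0 t; rewrite !scale0r. Qed.

Lemma tmul0r s : tmul s 0 = 0.
Proof. by have := tmulZr 0 s 0; rewrite !scale0r. Qed.

Lemma tmulA : associative tmul.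
Proof.
move=> r s t; elim/tensor_ind: r => [|a b|r r' IHr IHr'].
- by rewrite !tmul0l.
- elim/tensor_ind: s => [|c d|s s' IHs IHs'].
  + by rewrite tmul0l !tmul0r tmul0l.
  + elim/tensor_ind: t => [|e f|t t' IHt IHt'].
    * by rewrite !tmul0r.
    * by rewrite !tmul_pure !mulrA.
    * by rewrite !tmulDr IHt IHt'.
  + by rewrite tmulDl !tmulDr tmulDl IHs IHs'.
- by rewrite !tmulDl IHr IHr'.
Qed.

Lemma tmul1 t : tmul t (1 \ox 1) = t.
Proof.
elim/tensor_ind: t => [|a b|t t' IHt IHt']; first exact: tmul0l.
- by rewrite tmul_pure !mulr1.
- by rewrite tmulDl IHt IHt'.
Qed.

Lemma tmul1l t : tmul (1 \ox 1) t = t.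
Proof.
elim/tensor_ind: t => [|a b|t t' IHt IHt']; first exact: tmul0r.
- by rewrite tmul_pure !mul1r.
- by rewrite tmulDr IHt IHt'.
Qed.

(* [comul \o S] and [x |-> S x2 \ox S x1] are a left and a right convolution
   inverse of [comul] in the algebra of maps [H -> H \ox H]. *)
Lemma comul_antipode x : comul (S x) = \sum_(p <- sw x) S p.2 \ox S p.1.
Proof.
pose V y : tensor H H := \sum_(p <- sw y) S p.2 \ox S p.1.
have Vb : balanced (fun a b : H => S b \ox S a).
  by split=> *; rewrite !(linearD, linearZ) /= ?pureDl ?pureDr ?pureZl ?pureZr.
have VD y z : V (y + z) = V y + V z by exact: (swD _ _ Vb).
have VZ k y : V (k *: y) = k *: V y.
  rewrite /V (swZ _ _ Vb) scaler_sumr; apply: eq_bigr => p _.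
  by rewrite linearZ pureZr.
(* [V] is a right convolution inverse: the legs are [x1 S x4 \ox x2 S x3], where the inner pair
   cancels first and the outer pair after it. *)
have DV c : \sum_(p <- sw c) tmul (comul p.1) (V p.2) = counit c *: (1 \ox 1).
  pose h a b u v : tensor H H := (a * S v) \ox (b * S u).
  transitivity (\sum_(p <- sw c) \sum_(q <- sw p.1) \sum_(r <- sw p.2)
      h q.1 q.2 r.1 r.2).
    apply: eq_bigr => p _; rewrite [in LHS](tensor_seq (comul p.1)) tmul_suml.
    apply: eq_bigr => q _; rewrite tmul_sumr; apply: eq_bigr => r _.
    by rewrite tmul_pure.
  have hDa a a' b u v : h (a + a') b u v = h a b u v + h a' b u v.
    by rewrite /h mulrDl pureDl.
  have hDb a b b' u v : h a (b + b') u v = h a b u v + h a b' u v.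
    by rewrite /h mulrDl pureDr.
  have hDu a b u u' v : h a b (u + u') v = h a b u v + h a b u' v.
    by rewrite /h linearD mulrDr pureDr.
  have hDv a b u v v' : h a b u (v + v') = h a b u v + h a b u v'.
    by rewrite /h linearD mulrDr pureDl.
  have hZa k a b u v : h (k *: a) b u v = k *: h a b u v.
    by rewrite /h -scalerAl pureZl.
  have hZb k a b u v : h a (k *: b) u v = k *: h a b u v.
    by rewrite /h -scalerAl pureZr.
  have hZu k a b u v : h a b (k *: u) v = k *: h a b u v.
    by rewrite /h linearZ -scalerAr pureZr.
  have hZv k a b u v : h a b u (k *: v) = k *: h a b u v.
    by rewrite /h linearZ -scalerAr pureZl.
  rewrite (sw_coassoc
      (g := fun a b d => \sum_(r <- sw d) h a b r.1 r.2)); last first.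
    split=> w; last first.
      apply: (balanced3_swr (g := h w)).
      by split=> ?; split=> *; rewrite ?hDb ?hDu ?hDv ?hZb ?hZu ?hZv.
    split=> *; rewrite -?big_split /=; apply: eq_bigr => r _;
      by rewrite ?hDa ?hDb // hZa hZb.
  transitivity (\sum_(p <- sw c) (p.1 * S p.2) \ox (1 : H)).
    apply: eq_bigr => p _.
    rewrite -(sw_coassoc (g := h p.1)); last first.
      by split=> ?; split=> *; rewrite ?hDb ?hDu ?hDv ?hZb ?hZu ?hZv.
    transitivity (\sum_(q <- sw p.2) (p.1 * S (counit q.1 *: q.2)) \ox (1 : H)).
      apply: eq_bigr => q _; rewrite -pure_sumr sw_antipoder.
      by rewrite pureZr -pureZl linearZ -scalerAr.
    by rewrite -pure_suml -mulr_sumr -linear_sum sw_counitl.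
  by rewrite -pure_suml sw_antipoder pureZl.
(* The sum of [comul (S x1) comul x2 V x3] is contracted in two ways. *)
transitivity (\sum_(p <- sw x) \sum_(q <- sw p.2)
    tmul (comul (S p.1)) (tmul (comul q.1) (V q.2))).
  rewrite -[in LHS](sw_counitr x) !linear_sum /=; apply: eq_bigr => p _.
  by rewrite -tmul_sumr DV tmulZr tmul1 !linearZ.
rewrite -(sw_coassoc (g := fun a b c =>
    tmul (comul (S a)) (tmul (comul b) (V c)))); last first.
  by split=> w; split=> *; rewrite ?VD ?VZ ?(linearD, linearZ) /=;
     rewrite ?(tmulDl, tmulDr, tmulZl, tmulZr).
rewrite -/(V x) -[in RHS](sw_counitl x).
have -> : V (\sum_(p <- sw x) counit p.1 *: p.2) =
    \sum_(p <- sw x) counit p.1 *: V p.2.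
  elim: (sw x) => [|p s IHs]; last by rewrite !big_cons VD VZ IHs.
  by rewrite !big_nil; have := VZ 0 0; rewrite !scale0r.
apply: eq_bigr => p _.
transitivity (tmul (comul (\sum_(q <- sw p.1) S q.1 * q.2)) (V p.2)).
  rewrite linear_sum tmul_suml; apply: eq_bigr => q _.
  by rewrite tmulA /= comul_tmul.
by rewrite sw_antipodel linearZ /= comul1 tmulZl tmul1l.
Qed.

Lemma sw_antipode (A : zmodType) (f : H -> H -> A) x : balanced f ->
  \sum_(p <- sw (S x)) f p.1 p.2 = \sum_(p <- sw x) f (S p.2) (S p.1).
Proof.
move=> bf; rewrite (sw_eq (s := [seq (S p.2, S p.1) | p <- sw x])) //.
  by rewrite big_map.
by rewrite big_map comul_antipode.
Qed.

End HopfAlgebra.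

(** * The conjugate linear involution and the inverse of the antipode *)

Section CircHopf.
Variables (K : numClosedFieldType) (H : circHopfType K).
Implicit Types (x y : H).
Local Notation S := (@antipode K H).

Lemma circZ (k : K) x : circ (k *: x) = k^* *: circ x.
Proof. by rewrite linearZ. Qed.

Lemma sw_circ (A : zmodType) (f : H -> H -> A) x : balanced f ->
  \sum_(p <- sw (circ x)) f p.1 p.2 =
  \sum_(p <- sw x) f (circ p.2) (circ p.1).
Proof.
move=> bf; rewrite (sw_eq (s := [seq (circ p.2, circ p.1) | p <- sw x])) //.
  by rewrite big_map.
by rewrite big_map comul_circ.
Qed.

Lemma circ1 : circ (1 : H) = 1.
Proof. by have := circM (1 : H) (circ 1); rewrite mul1r circK mulr1. Qed.

(** The conjugate of [counit \o circ] is again a left counit, and every left counit agrees with the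
    right counit. *)
Lemma counit_circ x : counit (circ x) = (counit x)^*.
Proof.
have E : \sum_(p <- sw x) (counit (circ p.1))^* *: p.2 = x.
  apply: (can_inj (@circK K H)); rewrite linear_sum /=.
  under eq_bigr do rewrite circZ conjCK.
  rewrite -[RHS](sw_counitr (circ x)).
  rewrite (sw_circ (f := fun a b => counit b *: a)). by [].
  by bal.
rewrite -[in LHS](sw_counitr x) -[in RHS]E !linear_sum /= rmorph_sum.
apply: eq_bigr => p _ /=.
by rewrite circZ !linearZ rmorphM /= conjCK mulrC.
Qed.

(** This is the inverse of [antipode], by [skew_antipodeK] and [antipodeK]; bijectivity of the
    antipode thus comes from the involution. *)
Definition skew_antipode x := circ (S (circ x)).
Local Notation T := skew_antipode.

Lemma skew_antipodeD x y : T (x + y) = T x + T y.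
Proof. by rewrite /T !linearD. Qed.

Lemma skew_antipodeZ k x : T (k *: x) = k *: T x.
Proof. by rewrite /T circZ linearZ /= circZ conjCK. Qed.

Lemma sw_skew_antipode (A : zmodType) (f : H -> H -> A) x : balanced f ->
  \sum_(p <- sw (T x)) f p.1 p.2 = \sum_(p <- sw x) f (T p.2) (T p.1).
Proof.
move=> bf; have [fD fD' fZ] := bf.
rewrite sw_circ // (sw_antipode (f := fun a b => f (circ b) (circ a))).
  rewrite (sw_circ (f := fun a b => f (circ (S a)) (circ (S b)))) //.
  by split=> *; rewrite !(linearD, linearZ) /= ?fD ?fD' ?circZ ?fZ.
by split=> *; rewrite ?linearD ?circZ /= ?fD ?fD' ?fZ.
Qed.

Lemma sw_skew_antipodel x : \sum_(p <- sw x) T p.2 * p.1 = (counit x)%:A.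
Proof.
apply: (can_inj (@circK K H)); rewrite linear_sum /= circZ circ1 -counit_circ.
rewrite -sw_antipodel (sw_circ (f := fun a b => S a * b)); last by bal.
by apply: eq_bigr => p _; rewrite circM circK.
Qed.

Lemma sw_skew_antipoder x : \sum_(p <- sw x) p.2 * T p.1 = (counit x)%:A.
Proof.
apply: (can_inj (@circK K H)); rewrite linear_sum /= circZ circ1 -counit_circ.
rewrite -sw_antipoder (sw_circ (f := fun a b => a * S b)); last by bal.
by apply: eq_bigr => p _; rewrite circM circK.
Qed.

(** The sum of [x1 S x2 S (T x3)] is contracted in two ways; the second uses that
    [S x1 S (T x2) = S (T x2 x1)] sums to the counit. *)
Lemma skew_antipodeK : cancel T S.
Proof.
move=> x.
have E y : \sum_(p <- sw y) S p.1 * S (T p.2) = (counit y)%:A.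
  under eq_bigr do rewrite -antipodeM.
  by rewrite -linear_sum /= sw_skew_antipodel linearZ /= antipode1.
transitivity (\sum_(p <- sw x) (\sum_(q <- sw p.1) q.1 * S q.2) * S (T p.2)).
  under eq_bigr do rewrite sw_antipoder -scalerAl mul1r.
  rewrite -[in LHS](sw_counitl x) (big_morph T skew_antipodeD (_ : T 0 = 0)).
    by rewrite linear_sum; apply: eq_bigr => p _; rewrite skew_antipodeZ linearZ.
  by rewrite /T !linear0.
under eq_bigr do rewrite mulr_suml.
rewrite (sw_coassoc (g := fun a b c => a * S b * S (T c))); last first.
  by bal; rewrite ?skew_antipodeD ?skew_antipodeZ ?linearD ?linearZ /=
    ?mulrDr // -!scalerAr -?scalerAl.
rewrite -[RHS](sw_counitr x); apply: eq_bigr => p _.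
under eq_bigr do rewrite -mulrA.
by rewrite -mulr_sumr E -scalerAr mulr1.
Qed.

Lemma antipodeK : cancel S T.
Proof.
move=> x; apply: (can_inj (@circK K H)).
by have := skew_antipodeK (circ x); rewrite /T !circK.
Qed.

Lemma circ_skew_antipode x : circ (T x) = S (circ x).
Proof. exact: circK. Qed.

Lemma circ_antipode x : circ (S x) = T (circ x).
Proof. by rewrite /T circK. Qed.

Lemma antipode_circ_antipode x : S (circ (S x)) = circ x.
Proof. by rewrite circ_antipode skew_antipodeK. Qed.

End CircHopf.

(** * Hermitian forms and orthogonalization *)

(** Positivity is kept out of the record: [idot] is a form of this kind before it is known to be
    positive, and differences [b - l d] may be degenerate. *)
Record hform (K : numClosedFieldType) (V : lmodType K) := HForm {
  hform_fun :> V -> V -> K;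
  hform_scalar : forall z, scalar (hform_fun^~ z);
  hformC : forall x y, hform_fun y x = (hform_fun x y)^*
}.

Section HForm.
Variables (K : numClosedFieldType) (V : lmodType K).
Implicit Types (b : hform V) (x y z : V).

Lemma hformDl b x y z : b (x + y) z = b x z + b y z.
Proof. by have := @hform_scalar _ _ b z 1 x y; rewrite scale1r mul1r. Qed.

Lemma hformZl b k x z : b (k *: x) z = k * b x z.
Proof.
have b0 : b 0 z = 0.
  by apply: (addrI (b 0 z)); rewrite -hformDl !addr0.
by have := @hform_scalar _ _ b z k x 0; rewrite b0 !addr0.
Qed.

Lemma hformDr b x y z : b z (x + y) = b z x + b z y.
Proof. by rewrite hformC hformDl rmorphD /= -!hformC. Qed.

Lemma hformZr b k x z : b z (k *: x) = k^* * b z x.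
Proof. by rewrite hformC hformZl rmorphM /= -hformC. Qed.

Lemma hform0l b z : b 0 z = 0.
Proof. by rewrite -(scale0r 0) hformZl mul0r. Qed.

Lemma hform0r b z : b z 0 = 0.
Proof. by rewrite hformC hform0l rmorph0. Qed.

Lemma hformNl b x z : b (- x) z = - b x z.
Proof. by rewrite -scaleN1r hformZl mulN1r. Qed.

Lemma hform_suml b I (r : seq I) (F : I -> V) z :
  b (\sum_(i <- r) F i) z = \sum_(i <- r) b (F i) z.
Proof.
exact: (big_morph (b^~ z) (fun x y => hformDl b x y z) (hform0l b z)).
Qed.

Lemma hform_sumr b I (r : seq I) (F : I -> V) z :
  b z (\sum_(i <- r) F i) = \sum_(i <- r) b z (F i).
Proof. exact: (big_morph (b z) (fun x y => hformDr b x y z) (hform0r b z)). Qed.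

Lemma hform_eq0C b x y : b x y = 0 -> b y x = 0.
Proof. by move=> xy; rewrite hformC xy rmorph0. Qed.

Definition posdef b : Prop := forall x, x != 0 -> 0 < b x x.

Lemma posdef_ge0 b x : posdef b -> 0 <= b x x.
Proof.
by move=> bp; have [->|/bp/ltW//] := eqVneq x 0; rewrite hform0l.
Qed.

Lemma posdef_eq0 b x : posdef b -> b x x = 0 -> x = 0.
Proof.
by move=> bp bx; have [//|/bp] := eqVneq x 0; rewrite bx ltxx.
Qed.

Lemma posdef_ext b x y : posdef b -> (forall z, b x z = b y z) -> x = y.
Proof.
move=> bp xy; apply/eqP; rewrite -subr_eq0; apply/eqP/(posdef_eq0 bp).
by rewrite hformDl hformNl xy subrr.
Qed.

Lemma hform_balanced b (W : lmodType K) z :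
  balanced (fun (x : V) (w : W) => b x z *: w).
Proof.
split=> *; rewrite ?hformDl ?scalerDl ?scalerDr //.
by rewrite hformZl mulrC scalerA.
Qed.

(** Finite dimensionality of a subspace is expressed as inclusion in some [vspan s], and [size s]
    bounds the dimension in the inductions. *)
Fixpoint vspan (s : seq V) : V -> Prop :=
  if s is a :: s' then fun x => exists k, vspan s' (x - k *: a)
  else fun x => x = 0.

Definition subspace (E : V -> Prop) : Prop :=
  E 0 /\ forall k x y, E x -> E y -> E (k *: x + y).

Lemma subspaceD E x y : subspace E -> E x -> E y -> E (x + y).
Proof. by move=> [_ El] Ex Ey; rewrite -[x]scale1r; exact: El. Qed.

Lemma subspaceZ E k x : subspace E -> E x -> E (k *: x).
Proof. by move=> [E0 El] Ex; rewrite -[_ *: _]addr0; exact: El. Qed.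

Lemma subspaceB E x y : subspace E -> E x -> E y -> E (x - y).
Proof.
move=> sE Ex Ey; apply: subspaceD => //.
by rewrite -scaleN1r; exact: subspaceZ.
Qed.

Lemma subspace_sum E I (r : seq I) (P : pred I) (F : I -> V) : subspace E ->
  (forall i, P i -> E (F i)) -> E (\sum_(i <- r | P i) F i).
Proof.
move=> sE EF; apply: big_ind => //; first by case: sE.
by move=> x y; exact: subspaceD.
Qed.

Lemma subspace_sum_seq E (I : eqType) (r : seq I) (F : I -> V) : subspace E ->
  (forall i, i \in r -> E (F i)) -> E (\sum_(i <- r) F i).
Proof. by move=> sE EF; rewrite big_seq; exact: subspace_sum. Qed.

Lemma subspace_vspan s : subspace (vspan s).
Proof.
elim: s => [|a s [IH0 IHl]] /=.
  by split=> // k x y -> ->; rewrite scaler0 addr0.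
split=> [|k x y [l xl] [m ym]]; first by exists 0; rewrite scale0r subr0.
exists (k * l + m); have := IHl k _ _ xl ym; congr (vspan _ _).
by rewrite scalerBr scalerA scalerDl opprD addrACA.
Qed.

Lemma vspan_mem s x : x \in s -> vspan s x.
Proof.
elim: s => //= a s IHs; rewrite inE => /orP[/eqP->|xs].
  by exists 1; rewrite scale1r subrr; case: (subspace_vspan s).
by exists 0; rewrite scale0r subr0; exact: IHs.
Qed.

Lemma vspan_min s (E : V -> Prop) : subspace E -> (forall x, x \in s -> E x) ->
  forall x, vspan s x -> E x.
Proof.
move=> sE; elim: s => [|a s IHs] Es x /=; first by move->; case: sE.
move=> [k xk]; rewrite -(subrK (k *: a) x); apply: subspaceD => //.
  by apply: IHs => // y ys; apply: Es; rewrite inE ys orbT.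
by apply: subspaceZ => //; apply: Es; rewrite mem_head.
Qed.

(** By induction on [s]: generators of the part of [E] inside the span of the tail, and at most one
    further element of [E]. The last clause makes a proper subspace need strictly fewer
    generators. *)
Lemma subspace_vspanP s (E : V -> Prop) : subspace E ->
  (forall x, E x -> vspan s x) ->
  exists t, [/\ (size t <= size s)%N, forall x, x \in t -> E x,
    forall x, E x -> vspan t x
    & size t = size s -> forall x, vspan s x -> E x].
Proof.
elim: s E => [|a s IHs] E sE Es.
  by exists [::]; split=> // _ x ->; case: sE.
pose E' x := E x /\ vspan s x.
have sE' : subspace E'.
  split; first by split; [case: sE|case: (subspace_vspan s)].
  move=> k x y [Ex sx] [Ey sy]; split; first by apply: sE.2.
  by apply: (subspace_vspan s).2.
have [t [ts tE' E't teq]] := IHs E' sE' (fun x E'x => E'x.2).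
have [[e [Ee nse]]|nE] := pselect (exists e, E e /\ ~ vspan s e); last first.
  exists t; split=> [|x /tE'[]//|x Ex|teq1]; first exact: leqW.
    by apply: E't; split=> //; apply: contrapT => nsx; apply: nE; exists x.
  by move: ts; rewrite teq1 ltnn.
have [k ske] := Es e Ee.
have k0 : k != 0.
  by apply/eqP => k0; apply: nse; move: ske; rewrite k0 scale0r subr0.
exists (e :: t); split=> [|x|x Ex|/= [teq1] x [l sxl]] //=.
- by rewrite inE => /orP[/eqP->//|/tE'[]].
(* The multiple [l / k] of [e] has the same [a]-coefficient as [x], so the difference lies in the
   span of the tail. *)
- have [l sxl] := Es x Ex; exists (l / k); apply: E't; split.
    by apply: subspaceB => //; exact: subspaceZ.
  have := subspaceB (subspace_vspan s) sxl
    (subspaceZ (l / k) (subspace_vspan s) ske).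
  by rewrite scalerBr scalerA divfK // opprB addrA subrK.
(* Equality of sizes puts the whole span of the tail into [E]; then [a] is in [E] because [e] is,
   the coefficient [k] being nonzero. *)
- have sE'' y : vspan s y -> E y by move=> /(teq teq1)[].
  rewrite -(subrK (l *: a) x); apply: subspaceD => //; first exact: sE''.
  have -> : a = k^-1 *: (e - (e - k *: a)).
    by rewrite opprB addrC subrK scalerA mulVf // scale1r.
  apply: (subspaceZ _ sE); apply: (subspaceZ _ sE); apply: subspaceB => //.
  exact: sE''.
Qed.

Definition orthoseq b (e : seq V) : Prop :=
  pairwise (fun x y => b x y == 0) e /\ all (fun x => x != 0) e.

Definition hproj b (e : seq V) x : V := \sum_(a <- e) (b x a / b a a) *: a.

Lemma hproj_lin b e k x y :
  hproj b e (k *: x + y) = k *: hproj b e x + hproj b e y.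
Proof.
rewrite /hproj scaler_sumr -big_split; apply: eq_bigr => a _ /=.
by rewrite hformDl hformZl mulrDl scalerDl scalerA mulrA.
Qed.

Lemma orthoseq_cons b a e : orthoseq b (a :: e) <->
  [/\ forall x, x \in e -> b a x = 0, a != 0 & orthoseq b e].
Proof.
rewrite /orthoseq /=; split.
  move=> [/andP[/allP ae pe] /andP[a0 e0]]; split=> // x /ae/eqP//.
by move=> [ae a0 [pe e0]]; split; apply/andP; split=> //; apply/allP => x /ae ->.
Qed.

Lemma hproj_id b e x : posdef b -> orthoseq b e -> vspan e x -> hproj b e x = x.
Proof.
move=> bp; elim: e x => [|a e IHe] x; first by move=> _ ->; rewrite /hproj big_nil.
move=> /orthoseq_cons[ae a0 oe] /= [k xk]; rewrite /hproj big_cons.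
have xa : b (x - k *: a) a = 0.
  apply: (vspan_min (E := fun y => b y a = 0) _ _ xk).
    split=> [|l y z ya za]; first exact: hform0l.
    by rewrite hformDl hformZl ya za mulr0 addr0.
  by move=> y /ae/hform_eq0C.
have -> : b x a = k * b a a.
  by apply/eqP; rewrite -subr_eq0 -hformZl -hformNl -hformDl xa.
rewrite mulfK; last by rewrite gt_eqF // bp.
have := IHe _ oe xk; rewrite /hproj => E.
rewrite -[RHS](subrK (k *: a)) -[in RHS]E addrC; congr (_ + _).
rewrite big_seq [RHS]big_seq; apply: eq_bigr => y ye.
by rewrite hformDl hformNl hformZl ae // mulr0 subr0.
Qed.

Lemma hproj_sub b e (E : V -> Prop) x : subspace E ->
  (forall a, a \in e -> E a) -> E (hproj b e x).
Proof.
move=> sE Ee; apply: subspace_sum_seq => // a ae.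
by apply: subspaceZ => //; exact: Ee.
Qed.

Lemma hproj_ortho b e x a : posdef b -> orthoseq b e -> a \in e ->
  b (x - hproj b e x) a = 0.
Proof.
move=> bp; elim: e => //= c e IHe /orthoseq_cons[ce c0 oe].
rewrite /hproj big_cons opprD addrA addrAC inE => /orP[/eqP->|ae].
  rewrite hformDl hformNl hformZl hformDl hformNl hform_suml.
  rewrite big_seq big1 => [|y ye]; last first.
    by rewrite hformZl (hform_eq0C (ce _ ye)) mulr0.
  by rewrite subr0 divfK ?subrr // gt_eqF // bp.
by rewrite hformDl hformNl hformZl (ce a ae) mulr0 subr0 IHe.
Qed.

(** Gram-Schmidt, dropping each vector whose remainder is zero. *)
Lemma orthoseq_exists b (s : seq V) : posdef b ->
  exists e, [/\ orthoseq b e, (size e <= size s)%N,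
    forall x, x \in e -> vspan s x & forall x, vspan s x -> vspan e x].
Proof.
move=> bp; elim: s => [|a s [e [oe es sub sup]]]; first by exists [::].
have sa := subspace_vspan (a :: s).
have sse x : vspan s x -> vspan (a :: s) x by exists 0; rewrite scale0r subr0.
pose a' := a - hproj b e a.
have eE : vspan e (hproj b e a).
  by apply: hproj_sub; [exact: subspace_vspan|exact: vspan_mem].
have [a'0|a'0] := eqVneq a' 0.
  exists e; split=> //; [exact: leqW|by move=> x /sub/sse|].
  move=> x /= [k /sup xk]; rewrite -(subrK (k *: a) x).
  apply: subspaceD => //; first exact: subspace_vspan.
  apply: subspaceZ; first exact: subspace_vspan.
  by rewrite -(subrK (hproj b e a) a) -/a' a'0 add0r.
exists (a' :: e); split=> //.
- by apply/orthoseq_cons; split=> // x xe; exact: hproj_ortho.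
- move=> x; rewrite inE => /orP[/eqP->|/sub/sse//].
  apply: subspaceB => //; first by apply: vspan_mem; rewrite mem_head.
  by apply: hproj_sub => // y /sub/sse.
- move=> x /= [k /sup xk]; exists k; rewrite /a' scalerBr opprB addrCA addrC.
  apply: subspaceD => //; first exact: subspace_vspan.
  by apply: subspaceZ => //; exact: subspace_vspan.
Qed.

Lemma orthoseq_subspace b (s : seq V) (E : V -> Prop) : posdef b ->
  subspace E -> (forall x, E x -> vspan s x) ->
  exists e, [/\ orthoseq b e, forall x, x \in e -> E x
    & forall x, E x -> vspan e x].
Proof.
move=> bp sE Es; have [t [_ tE Et _]] := subspace_vspanP sE Es.
have [e [oe _ et te]] := orthoseq_exists t bp; exists e; split=> // x.
  by move=> /et; exact: vspan_min.
by move=> /Et/te.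
Qed.

End HForm.

(** * Invariant forms *)

Section TensorForms.
Variables (K : numClosedFieldType) (U V : lmodType K) (b : hform U).
Hypothesis bp : posdef b.

(** The first legs are expanded along an orthogonal basis of their span; the second legs then become
    contractions of [t] against [b]. *)
Lemma tensor_ortho_expand (t : tensor U V) : exists2 e, orthoseq b e &
  t = \sum_(a <- e) a \ox ((b a a)^-1 *: tlift (fun x y => b x a *: y) t).
Proof.
have [e [oe _ _ te]] := orthoseq_exists (unzip1 (repr t)) bp.
exists e => //; rewrite {1}(tensor_seq t) big_seq.
transitivity (\sum_(p <- repr t) \sum_(a <- e) (b p.1 a / b a a) *: (a \ox p.2)).
  rewrite [RHS]big_seq; apply: eq_bigr => p pt.
  rewrite -[in LHS](hproj_id bp oe (x := p.1)); last first.
    by apply: te; apply: vspan_mem; apply/mapP; exists p.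
  by rewrite pure_suml; apply: eq_bigr => a _; rewrite pureZl.
rewrite exchange_big; apply: eq_bigr => a _ /=.
rewrite pureZr /tlift /tsum pure_sumr scaler_sumr; apply: eq_bigr => p _.
by rewrite pureZr scalerA mulrC.
Qed.

(** Contractions against a positive definite form separate tensors; this does the work of linear
    independence in infinite dimension. *)
Lemma tensor_eq0 (t : tensor U V) :
  (forall w, tlift (fun x y => b x w *: y) t = 0) -> t = 0.
Proof.
move=> t0; have [e _ ->] := tensor_ortho_expand t.
by rewrite big1 // => a _; rewrite t0 scaler0 pure0r.
Qed.

End TensorForms.

Lemma orthoseq_sum (K : numClosedFieldType) (V : lmodType K) (b : hform V)
    (e : seq V) (F : V -> V -> K) : orthoseq b e ->
  (forall x y, b x y = 0 -> F x y = 0) ->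
  \sum_(x <- e) \sum_(y <- e) F x y = \sum_(x <- e) F x x.
Proof.
move=> + F0; elim: e => [|a e IHe]; first by rewrite !big_nil.
move=> /orthoseq_cons[ae _ /IHe {}IHe]; rewrite !big_cons -IHe.
rewrite [X in _ + X + _]big_seq big1 ?addr0 => [|x /ae/F0//].
congr (_ + _); rewrite big_seq [RHS]big_seq; apply: eq_bigr => x xe.
by rewrite big_cons (F0 x) ?add0r //; exact/hform_eq0C/ae.
Qed.

Section Invariance.
Variables (K : numClosedFieldType) (H : circHopfType K).
Implicit Types (b : hform H) (x y : H).
Local Notation S := (@antipode K H).
Local Notation theta x := (S (S (circ x))).

(** The condition [unitary_dot] for the regular comodule. *)
Definition right_invariant b : Prop := forall u v : H,
  \sum_(p <- sw u) b p.1 v *: p.2 = \sum_(p <- sw v) b u p.1 *: circ p.2.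

(* The twist by [S \o S] is the one satisfied by [phi (S y° * x)]. *)
Definition left_invariant b : Prop := forall u v : H,
  \sum_(p <- sw u) b p.2 v *: p.1 = \sum_(p <- sw v) b u p.2 *: theta p.1.

Lemma hform_balanced_circ b u : balanced (fun a c : H => b u a *: circ c).
Proof.
split=> *; rewrite ?hformDr ?linearD ?scalerDl ?scalerDr //.
by rewrite hformZr circZ scalerA mulrC.
Qed.

Lemma hform_balanced_theta b u : balanced (fun a c : H => b u c *: theta a).
Proof.
split=> *; rewrite ?hformDr ?linearD ?scalerDl ?scalerDr //.
by rewrite hformZr circZ !linearZ /= scalerA mulrC.
Qed.

Section TensorForm.
Variables b1 b2 : hform H.

(** The pullback along [comul] of the product form on [H \ox H]. *)
Definition tform_fun x y : K :=
  \sum_(p <- sw x) \sum_(q <- sw y) b1 p.1 q.1 * b2 p.2 q.2.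

Let bl y : balanced (fun u v => \sum_(q <- sw y) b1 u q.1 * b2 v q.2).
Proof.
split=> *; rewrite -?big_split; apply: eq_bigr => q _ /=.
- by rewrite hformDl mulrDl.
- by rewrite hformDl mulrDr.
- by rewrite !hformZl mulrCA mulrA.
Qed.

Let br u v : balanced (fun x y => b1 u x * b2 v y).
Proof.
split=> *; rewrite ?hformDr ?mulrDl ?mulrDr //.
by rewrite !hformZr mulrCA mulrA.
Qed.

Lemma tform_scalar z : scalar (tform_fun^~ z).
Proof.
move=> k x y; rewrite /tform_fun (swD _ _ (bl z)) (swZ _ _ (bl z)) mulr_sumr.
congr (_ + _); apply: eq_bigr => p _; rewrite mulr_sumr; apply: eq_bigr => q _.
by rewrite hformZl mulrA.
Qed.

Lemma tformC x y : tform_fun y x = (tform_fun x y)^*.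
Proof.
rewrite /tform_fun rmorph_sum exchange_big; apply: eq_bigr => p _ /=.
rewrite rmorph_sum; apply: eq_bigr => q _.
by rewrite rmorphM /= -!hformC.
Qed.

Definition tform := HForm tform_scalar tformC.

Lemma tform_seq x (s : seq (H * H)) : comul x = \sum_(p <- s) p.1 \ox p.2 ->
  tform x x = \sum_(p <- s) \sum_(q <- s) b1 p.1 q.1 * b2 p.2 q.2.
Proof.
move=> xs; rewrite [LHS](sw_eq (bl x) xs); apply: eq_bigr => p _.
exact: (sw_eq (br p.1 p.2) xs).
Qed.

Lemma tform_ortho x : posdef b1 -> exists e (v : H -> H),
  comul x = \sum_(a <- e) a \ox v a /\
  tform x x = \sum_(a <- e) b1 a a * b2 (v a) (v a).
Proof.
move=> bp1; have [e oe xe] := tensor_ortho_expand bp1 (comul x).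
pose v a := (b1 a a)^-1 *: tlift (fun y z => b1 y a *: z) (comul x).
exists e, v; split=> //.
rewrite (@tform_seq x [seq (a, v a) | a <- e]); last by rewrite big_map.
rewrite big_map; under eq_bigr do rewrite big_map.
by apply: orthoseq_sum oe _ => a c ac; rewrite ac mul0r.
Qed.

(** With orthogonal first legs the value is a sum of nonnegative terms. If it vanishes, every term
    [a \ox v a] of the coproduct is zero, and [comul] is injective. *)
Lemma tform_posdef : posdef b1 -> posdef b2 -> posdef tform.
Proof.
move=> bp1 bp2 x x0; have [e [v [xe ->]]] := tform_ortho x bp1.
have ge0 a : true -> 0 <= b1 a a * b2 (v a) (v a).
  by move=> _; apply: mulr_ge0; exact: posdef_ge0.
rewrite lt_neqAle sumr_ge0 // andbT eq_sym; apply: contra x0.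
rewrite psumr_eq0 // => /allP e0; apply/eqP/sw_inj; rewrite xe big_seq big1 // => a.
move=> /e0/=; rewrite mulf_eq0 => /orP[/eqP/(posdef_eq0 bp1)->|].
  by rewrite pure0l.
by move=> /eqP/(posdef_eq0 bp2)->; rewrite pure0r.
Qed.

(** Coassociativity splits the free last leg off the leg fed to [b2], whose invariance moves it to
    the other argument. *)
Lemma tform_right_invariant : right_invariant b2 -> right_invariant tform.
Proof.
move=> rb u v.
transitivity (\sum_(p <- sw u) \sum_(q <- sw v)
    b1 p.1 q.1 *: \sum_(r <- sw p.2) b2 r.1 q.2 *: r.2).
  transitivity (\sum_(p <- sw u) \sum_(r <- sw p.2)
      \sum_(q <- sw v) (b1 p.1 q.1 * b2 r.1 q.2) *: r.2); last first.
    apply: eq_bigr => p _; rewrite exchange_big; apply: eq_bigr => q _.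
    by rewrite scaler_sumr; apply: eq_bigr => r _; rewrite scalerA.
  rewrite -(sw_coassoc (g := fun a c d =>
    \sum_(q <- sw v) (b1 a q.1 * b2 c q.2) *: d)); last first.
    split=> w; split=> *; rewrite -?big_split; apply: eq_bigr => q _ /=;
      rewrite ?hformDl ?mulrDl ?mulrDr ?scalerDl ?scalerDr //= ?hformZl.
      by rewrite mulrCA mulrA.
    by rewrite scalerA mulrCA mulrC.
  apply: eq_bigr => p _; rewrite /= /tform_fun scaler_suml.
  by apply: eq_bigr => r _; rewrite scaler_suml.
transitivity (\sum_(p <- sw u) \sum_(q <- sw v) \sum_(r <- sw q.2)
    (b1 p.1 q.1 * b2 p.2 r.1) *: circ r.2).
  apply: eq_bigr => p _; apply: eq_bigr => q _; rewrite rb scaler_sumr.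
  by apply: eq_bigr => r _; rewrite scalerA.
rewrite exchange_big /=.
rewrite [RHS](_ : _ = \sum_(q <- sw v) \sum_(r <- sw q.1) \sum_(p <- sw u)
    (b1 p.1 r.1 * b2 p.2 r.2) *: circ q.2); last first.
  apply: eq_bigr => q _; rewrite exchange_big /= scaler_suml.
  by apply: eq_bigr => p _; rewrite scaler_suml.
rewrite (sw_coassoc (g := fun a c d =>
    \sum_(p <- sw u) (b1 p.1 a * b2 p.2 c) *: circ d)); last first.
  split=> w; split=> *; rewrite -?big_split; apply: eq_bigr => q _ /=;
    rewrite ?hformDr ?mulrDl ?mulrDr ?linearD ?scalerDl ?scalerDr //= ?hformZr.
    by rewrite mulrCA mulrA.
  by rewrite circZ scalerA mulrCA mulrC.
by apply: eq_bigr => q _; rewrite exchange_big.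
Qed.

(** The mirror image: the free leg is now the first and sits next to the one fed to [b1]. *)
Lemma tform_left_invariant : left_invariant b1 -> left_invariant tform.
Proof.
move=> lb u v.
transitivity (\sum_(p <- sw u) \sum_(q <- sw v)
    b2 p.2 q.2 *: \sum_(r <- sw p.1) b1 r.2 q.1 *: r.1).
  transitivity (\sum_(p <- sw u) \sum_(r <- sw p.1)
      \sum_(q <- sw v) (b1 r.2 q.1 * b2 p.2 q.2) *: r.1); last first.
    apply: eq_bigr => p _; rewrite exchange_big; apply: eq_bigr => q _.
    by rewrite scaler_sumr; apply: eq_bigr => r _; rewrite scalerA mulrC.
  rewrite (sw_coassoc (g := fun d a c =>
    \sum_(q <- sw v) (b1 a q.1 * b2 c q.2) *: d)); last first.
    split=> w; split=> *; rewrite -?big_split; apply: eq_bigr => q _ /=;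
    rewrite ?hformDl ?mulrDl ?mulrDr ?scalerDl ?scalerDr //= ?hformZl.
      by rewrite scalerA mulrC mulrA.
    by rewrite mulrCA mulrA.
  apply: eq_bigr => p _; rewrite /= /tform_fun scaler_suml.
  by apply: eq_bigr => r _; rewrite scaler_suml.
transitivity (\sum_(p <- sw u) \sum_(q <- sw v) \sum_(r <- sw q.1)
    (b1 p.1 r.2 * b2 p.2 q.2) *: theta r.1).
  apply: eq_bigr => p _; apply: eq_bigr => q _; rewrite lb scaler_sumr.
  by apply: eq_bigr => r _; rewrite scalerA mulrC.
rewrite exchange_big /=.
rewrite [RHS](_ : _ = \sum_(q <- sw v) \sum_(r <- sw q.2) \sum_(p <- sw u)
    (b1 p.1 r.1 * b2 p.2 r.2) *: theta q.1); last first.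
  apply: eq_bigr => q _; rewrite exchange_big /= scaler_suml.
  by apply: eq_bigr => p _; rewrite scaler_suml.
rewrite -(sw_coassoc (g := fun d a c =>
    \sum_(p <- sw u) (b1 p.1 a * b2 p.2 c) *: theta d)); last first.
  split=> w; split=> *; rewrite -?big_split; apply: eq_bigr => q _ /=;
    rewrite ?hformDr ?mulrDl ?mulrDr ?linearD ?scalerDl ?scalerDr //= ?hformZr.
    by rewrite circZ !linearZ /= scalerA mulrA.
  by rewrite mulrCA mulrA.
by apply: eq_bigr => q _; rewrite exchange_big.
Qed.

End TensorForm.

End Invariance.

(** * Finite-dimensional subcoalgebras *)

Section Subcoalgebras.
Variables (K : numClosedFieldType) (C : coalgType K).
Implicit Types (x y : C) (D E : set C).

Lemma scalarfD (f : C -> K) u v : scalar f -> f (u + v) = f u + f v.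
Proof. by move=> fl; rewrite -[u]scale1r fl mul1r scale1r. Qed.

Lemma scalarf0 (f : C -> K) : scalar f -> f 0 = 0.
Proof. by move=> fl; apply: (addrI (f 0)); rewrite -scalarfD // !addr0. Qed.

Lemma scalarfZ (f : C -> K) k u : scalar f -> f (k *: u) = k * f u.
Proof. by move=> fl; rewrite -[k *: u]addr0 fl scalarf0 // addr0. Qed.

Lemma scalarf_sum (f : C -> K) I (r : seq I) (F : I -> C) : scalar f ->
  f (\sum_(i <- r) F i) = \sum_(i <- r) f (F i).
Proof.
by move=> fl; apply: big_morph => [u v|]; [exact: scalarfD|exact: scalarf0].
Qed.

Lemma scalar_balanced (f : C -> K) : scalar f ->
  balanced (fun x y : C => f x *: y).
Proof.
move=> fl; split=> [u1 u2 v|u v1 v2|k u v].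
- by rewrite scalarfD // scalerDl.
- by rewrite scalerDr.
- by rewrite scalarfZ // mulrC scalerA.
Qed.

Lemma scalar_balancedr (f : C -> K) : scalar f ->
  balanced (fun x y : C => f y *: x).
Proof.
move=> /scalar_balanced[fD D' fZ].
by split=> [u1 u2 v|u v1 v2|k u v]; rewrite -?fZ.
Qed.

Lemma subcoalgebra_subspace D : subcoalgebra D -> subspace D.
Proof. by case. Qed.

Lemma subcoalgebra_sw D (A : zmodType) (f : C -> C -> A) x :
  subcoalgebra D -> D x -> balanced f ->
  (forall a c, D a -> D c -> f a c = 0) -> \sum_(p <- sw x) f p.1 p.2 = 0.
Proof.
move=> [_ _ Ds] /Ds[s sD xs] bf f0; rewrite (sw_eq bf xs) big_seq big1 // => p.
by move=> /sD[D1 D2]; exact: f0.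
Qed.

(** Closure under the left and right actions of all linear functionals on [C]. *)
Definition costable D := forall f, scalar f -> forall x, D x ->
  D (\sum_(p <- sw x) f p.1 *: p.2) /\ D (\sum_(p <- sw x) f p.2 *: p.1).

Lemma subcoalgebra_costable D : subcoalgebra D -> costable D.
Proof.
move=> sD f fl x Dx; have [_ _ /(_ x Dx)[s sD' xs]] := sD.
rewrite (sw_eq (scalar_balanced fl) xs) (sw_eq (scalar_balancedr fl) xs).
by split; apply: subspace_sum_seq => [|p /sD'[D1 D2]];
  try exact: subcoalgebra_subspace; apply: subspaceZ => //;
  exact: subcoalgebra_subspace.
Qed.

(** With [q] the orthogonal projection onto [D], contractions show that [comul x] is fixed by [q] on
    either leg. Hence the pairs [(q x1, q x2)] represent it. *)
Lemma costable_subcoalgebra (b : hform C) (s : seq C) D : posdef b ->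
  subspace D -> (forall x, D x -> vspan s x) -> costable D -> subcoalgebra D.
Proof.
move=> bp sD Ds cD; have [e [oe eD De]] := orthoseq_subspace bp sD Ds.
split; [by case: sD|by case: sD|move=> x Dx].
pose q := hproj b e.
have qD y : D (q y) by exact: hproj_sub.
have qid y : D y -> q y = y by move=> /De; exact: hproj_id.
have q_sum I (r : seq I) (F : I -> C) (c : I -> K) :
    q (\sum_(i <- r) c i *: F i) = \sum_(i <- r) c i *: q (F i).
  elim: r => [|i r IHr]; last by rewrite !big_cons /q hproj_lin -/q IHr.
  by rewrite !big_nil qid //; case: sD.
have Dx1 w : D (\sum_(p <- sw x) b p.1 w *: p.2).
  exact: (cD _ (hform_scalar b w) x Dx).1.
have Dx2 w : D (\sum_(p <- sw x) b p.2 w *: p.1).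
  exact: (cD _ (hform_scalar b w) x Dx).2.
have E1 : \sum_(p <- sw x) p.1 \ox (p.2 - q p.2) = 0.
  apply: (tensor_eq0 bp) => w; have bf := hform_balanced b C w.
  rewrite tlift_sum //; under eq_bigr do rewrite tlift_pure // scalerBr.
  by rewrite sumrB -q_sum qid ?subrr.
(* The second legs [q p.2] are expanded along [e]; the coefficient of each basis vector is a
   contraction of [comul x], hence lies in [D] and is fixed by [q]. *)
have E2 : \sum_(p <- sw x) (p.1 - q p.1) \ox q p.2 = 0.
  transitivity (\sum_(a <- e)
      (\sum_(p <- sw x) (b p.2 a / b a a) *: (p.1 - q p.1)) \ox a).
    under [RHS]eq_bigr do rewrite pure_suml.
    rewrite exchange_big /=; apply: eq_bigr => p _.
    rewrite /q {2}/hproj pure_sumr; apply: eq_bigr => a _.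
    by rewrite pureZr pureZl.
  rewrite big1 // => a _.
  transitivity (((b a a)^-1 *: \sum_(p <- sw x) b p.2 a *: (p.1 - q p.1)) \ox a).
    congr (_ \ox _); rewrite scaler_sumr; apply: eq_bigr => p _.
    by rewrite scalerA mulrC.
  under eq_bigr do rewrite scalerBr.
  by rewrite sumrB -q_sum qid ?subrr ?scaler0 ?pure0l.
exists [seq (q p.1, q p.2) | p <- sw x].
  by move=> p /mapP[r _ ->] /=; split; exact: qD.
rewrite big_map {1}(tensor_seq (comul x)) /=; apply: subr0_eq.
transitivity (\sum_(p <- sw x) p.1 \ox (p.2 - q p.2) +
              \sum_(p <- sw x) (p.1 - q p.1) \ox q p.2); last first.
  by rewrite E1 E2 addr0.
rewrite -big_split -sumrB /=.
apply: eq_bigr => p _; have [Dl Dr _] := @balanced_pure K C C.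
have Nr (u v : C) : u \ox (- v) = - (u \ox v) by rewrite -!scaleN1r pureZr.
have Nl (u v : C) : (- u) \ox v = - (u \ox v) by rewrite -!scaleN1r pureZl.
by rewrite Dr Dl Nr Nl addrA subrK.
Qed.

Lemma sw_sum (A : zmodType) (f : C -> C -> A) I (r : seq I) (F : I -> C) :
  balanced f -> \sum_(p <- sw (\sum_(i <- r) F i)) f p.1 p.2 =
  \sum_(i <- r) \sum_(p <- sw (F i)) f p.1 p.2.
Proof. by move=> bf; rewrite linear_sum; exact: tlift_sum. Qed.

Lemma sw_scale (f : C -> C -> C) k x :
  balanced f -> (forall k a b, f (k *: a) b = k *: f a b) ->
  \sum_(p <- sw (k *: x)) f p.1 p.2 = k *: \sum_(p <- sw x) f p.1 p.2.
Proof.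
by move=> bf fZ; rewrite swZ // scaler_sumr; apply: eq_bigr.
Qed.

(* The elements [F(x1, x3) x2] with [F] bilinear: a finite-dimensional
   subcoalgebra containing [x]. *)
Definition middle_coefficients x (y : C) : Prop := exists F : C -> C -> K,
  [/\ forall c, scalar (F^~ c), forall a, scalar (F a)
    & y = \sum_(p <- sw x) \sum_(q <- sw p.2) F p.1 q.2 *: q.1].

Lemma middle_coefficients_subspace x : subspace (middle_coefficients x).
Proof.
split.
  exists (fun _ _ => 0); split=> [c k u v|a k u v|]; rewrite ?mulr0 ?addr0 //.
  by rewrite big1 // => p _; rewrite big1 // => q _; rewrite scale0r.
move=> k y z [F [F1 F2 ->]] [G [G1 G2 ->]].
exists (fun a c => k * F a c + G a c); split.
- by move=> c l u v /=; rewrite F1 G1 !mulrDr addrACA mulrCA.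
- by move=> a l u v /=; rewrite F2 G2 !mulrDr addrACA mulrCA.
rewrite scaler_sumr -big_split; apply: eq_bigr => p _ /=.
rewrite scaler_sumr -big_split; apply: eq_bigr => q _ /=.
by rewrite scalerDl scalerA.
Qed.

Lemma middle_coefficients_refl x : middle_coefficients x x.
Proof.
exists (fun a c => counit a * counit c); split.
- by move=> c k u v; rewrite linearP mulrDl mulrA.
- by move=> a k u v; rewrite linearP mulrDr mulrCA.
rewrite -[LHS]sw_counitl; apply: eq_bigr => p _.
rewrite -[in LHS](sw_counitr p.2) scaler_sumr; apply: eq_bigr => q _.
by rewrite scalerA.
Qed.

Lemma middle_coefficients_span x : exists s,
  forall y, middle_coefficients x y -> vspan s y.
Proof.
exists (flatten [seq [seq q.1 | q <- sw p.2] | p <- sw x]).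
move=> y [F [_ _ ->]].
apply: subspace_sum_seq => [|p px]; first exact: subspace_vspan.
apply: subspace_sum_seq => [|q qp]; first exact: subspace_vspan.
apply: subspaceZ; first exact: subspace_vspan.
apply/vspan_mem/flatten_mapP; exists p => //; exact: map_f.
Qed.

(** The functional is absorbed into the bilinear form: [f (x2) F(x1, x4) x3] is again a middle
    coefficient, for the form [F(a1, d) f(a2)], and symmetrically on the right. *)
Lemma middle_coefficients_costable x : costable (middle_coefficients x).
Proof.
move=> f fl y [F [F1 F2 ->]]; have bf := scalar_balanced fl.
have bf' := scalar_balancedr fl.
have FD c u v : F (u + v) c = F u c + F v c by exact: scalarfD (F1 c).
have FD' c u v : F c (u + v) = F c u + F c v by exact: scalarfD (F2 c).
have FZ c k u : F (k *: u) c = k * F u c by exact: scalarfZ (F1 c).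
have FZ' c k u : F c (k *: u) = k * F c u by exact: scalarfZ (F2 c).
have fD u v : f (u + v) = f u + f v by exact: scalarfD.
have fZ k u : f (k *: u) = k * f u by exact: scalarfZ.
have swsum (g : C -> C -> C) : balanced g ->
  (forall k a b, g (k *: a) b = k *: g a b) ->
  \sum_(r <- sw (\sum_(p <- sw x) \sum_(q <- sw p.2) F p.1 q.2 *: q.1)) g r.1 r.2 =
  \sum_(p <- sw x) \sum_(q <- sw p.2) \sum_(r <- sw q.1) F p.1 q.2 *: g r.1 r.2.
  move=> bg gZ; rewrite sw_sum //; apply: eq_bigr => p _.
  rewrite sw_sum //; apply: eq_bigr => q _.
  by rewrite sw_scale // scaler_sumr.
split.
  rewrite (swsum (fun a c => f a *: c)) //; last first.
    by move=> k a c; rewrite fZ scalerA.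
  exists (fun a d => \sum_(q <- sw a) f q.2 * F q.1 d); split.
  - move=> c k u v; rewrite (swD _ _ (f := fun a d => f d * F a c)).
      rewrite (swZ _ _ (f := fun a d => f d * F a c)).
        rewrite mulr_sumr; congr (_ + _); apply: eq_bigr => q _.
        by rewrite FZ mulrCA.
      by split=> *; rewrite ?FD ?fD ?mulrDl ?mulrDr // FZ fZ mulrCA mulrA.
    by split=> *; rewrite ?FD ?fD ?mulrDl ?mulrDr // FZ fZ mulrCA mulrA.
  - move=> a k u v; rewrite mulr_sumr -big_split; apply: eq_bigr => q _ /=.
    by rewrite FD' FZ' mulrDr mulrCA.
  transitivity (\sum_(p <- sw x) \sum_(q <- sw p.2) \sum_(r <- sw q.2)
      (F p.1 r.2 * f q.1) *: r.1).
    apply: eq_bigr => p _.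
    rewrite -(sw_coassoc (g := fun a c d => (F p.1 d * f a) *: c)).
      by apply: eq_bigr => q _; apply: eq_bigr => r _; rewrite scalerA.
    split=> w; split=> *; rewrite ?FD' ?fD ?mulrDl ?mulrDr ?scalerDl ?scalerDr //.
      by rewrite fZ scalerA mulrCA mulrC.
    by rewrite FZ' scalerA mulrC mulrA.
  rewrite -(sw_coassoc (g := fun a c d =>
      \sum_(r <- sw d) (F a r.2 * f c) *: r.1)).
    apply: eq_bigr => p _; rewrite exchange_big; apply: eq_bigr => q _ /=.
    by rewrite scaler_suml; apply: eq_bigr => r _; rewrite mulrC.
  split=> w.
    split=> *; rewrite -?big_split; apply: eq_bigr => q _ /=.
    - by rewrite FD mulrDl scalerDl.
    - by rewrite fD mulrDr scalerDl.
    - by rewrite FZ fZ mulrCA mulrA.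
  apply: (balanced3_swr (g := fun c r1 r2 => (F w r2 * f c) *: r1)).
  split=> u; split=> *; rewrite ?FD' ?fD ?mulrDl ?mulrDr ?scalerDl ?scalerDr //.
    by rewrite fZ scalerA mulrCA mulrC.
  by rewrite FZ' scalerA mulrC mulrA.
rewrite (swsum (fun a c => f c *: a)) //; last first.
  by move=> k a c; rewrite !scalerA mulrC.
exists (fun a d => \sum_(r <- sw d) f r.1 * F a r.2); split.
- move=> c k u v; rewrite mulr_sumr -big_split; apply: eq_bigr => q _ /=.
  by rewrite FD FZ mulrDr mulrCA.
- move=> a k u v; rewrite (swD _ _ (f := fun c d => f c * F a d)).
    rewrite (swZ _ _ (f := fun c d => f c * F a d)).
      rewrite mulr_sumr; congr (_ + _); apply: eq_bigr => q _.
      by rewrite fZ mulrA.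
    by split=> *; rewrite ?FD' ?fD ?mulrDl ?mulrDr // FZ' fZ mulrCA mulrA.
  by split=> *; rewrite ?FD' ?fD ?mulrDl ?mulrDr // FZ' fZ mulrCA mulrA.
apply: eq_bigr => p _.
rewrite (sw_coassoc (g := fun c d e => F p.1 e *: (f d *: c))).
  apply: eq_bigr => q _; rewrite scaler_suml.
  by apply: eq_bigr => r _; rewrite scalerA mulrC.
split=> w; split=> *; rewrite ?FD' ?fD ?scalerDl ?scalerDr //.
  by rewrite fZ !scalerA mulrCA mulrC.
by rewrite FZ' fZ !scalerA; rewrite mulrCA mulrA.
Qed.

(** Local finiteness of coalgebras. *)
Lemma finite_subcoalgebra (b : hform C) x : posdef b -> exists (D : set C) s,
  [/\ subcoalgebra D, D x & forall y, D y -> vspan s y].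
Proof.
move=> bp; have [s Ds] := middle_coefficients_span x.
exists (middle_coefficients x), s; split=> //; last exact: middle_coefficients_refl.
apply: (costable_subcoalgebra bp _ Ds); first exact: middle_coefficients_subspace.
exact: middle_coefficients_costable.
Qed.

End Subcoalgebras.

(** * Orthogonal splitting into simple subcoalgebras *)

Section Semisimplicity.
Variables (K : numClosedFieldType) (H : circHopfType K).
Implicit Types (b : hform H) (x y : H) (D E : set H).
Local Notation S := (@antipode K H).
Local Notation T := (@skew_antipode K H).

Definition perp b D E : set H := fun x => D x /\ forall e, E e -> b x e = 0.

Lemma perp_subspace b D E : subcoalgebra D -> subspace (perp b D E).
Proof.
move=> [D0 Dl _]; split; first by split=> // e _; rewrite hform0l.
move=> k x y [Dx xE] [Dy yE]; split; first exact: Dl.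
by move=> e Ee; rewrite hformDl hformZl xE // yE // mulr0 addr0.
Qed.

(** Invariance moves the leg met by [f] from [x] to [e]. The other leg of [e] still lies in [E], so
    it is orthogonal to [x]. *)
Lemma perp_costable b D E : right_invariant b -> left_invariant b ->
  subcoalgebra D -> subcoalgebra E -> costable (perp b D E).
Proof.
move=> rb lb sD sE f fl x [Dx xE].
have [D1 D2] := subcoalgebra_costable sD fl Dx.
split; split=> // e Ee; rewrite hform_suml.
  transitivity (f (\sum_(p <- sw x) b p.2 e *: p.1)).
    rewrite scalarf_sum //; apply: eq_bigr => p _.
    by rewrite hformZl scalarfZ // mulrC.
  rewrite lb (subcoalgebra_sw sE Ee (hform_balanced_theta b x)) ?scalarf0 //.
  by move=> a c _ Ec; rewrite xE // scale0r.
transitivity (f (\sum_(p <- sw x) b p.1 e *: p.2)).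
  rewrite scalarf_sum //; apply: eq_bigr => p _.
  by rewrite hformZl scalarfZ // mulrC.
rewrite rb (subcoalgebra_sw sE Ee (hform_balanced_circ b x)) ?scalarf0 //.
by move=> a c Ea _; rewrite xE // scale0r.
Qed.

(** Two forms occur because [b] may be degenerate, as for eigenspaces; the positive definite [d]
    turns costability into a subcoalgebra. *)
Lemma perp_subcoalgebra (d : hform H) b s D E : posdef d ->
  right_invariant b -> left_invariant b ->
  subcoalgebra D -> (forall x, D x -> vspan s x) -> subcoalgebra E ->
  subcoalgebra (perp b D E).
Proof.
move=> dp rb lb sD Ds sE; apply: (@costable_subcoalgebra _ _ d s) => //.
- exact: perp_subspace.
- by move=> x [/Ds].
- exact: perp_costable.
Qed.

Lemma perp_split b s D E x : posdef b ->
  subspace D -> (forall x, D x -> vspan s x) -> subspace E ->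
  (forall x, E x -> D x) -> D x ->
  exists e, E e /\ perp b D E (x - e).
Proof.
move=> bp sD Ds sE ED Dx.
have [e [oe eE Ee]] := orthoseq_subspace bp sE (fun x Ex => Ds x (ED x Ex)).
exists (hproj b e x); split; first exact: hproj_sub.
split; first by apply: subspaceB => //; apply/ED; exact: hproj_sub.
move=> y /Ee; apply: (vspan_min (E := fun y => b (x - hproj b e x) y = 0)).
  2: by move=> a; exact: hproj_ortho.
split=> [|k u v u0 v0]; first exact: hform0r.
by rewrite hformDr hformZr u0 v0 mulr0 addr0.
Qed.

Lemma subspace_smaller s E x : subspace E -> (forall x, E x -> vspan s x) ->
  vspan s x -> ~ E x ->
  exists t, (size t < size s)%N /\ (forall x, E x -> vspan t x).
Proof.
move=> sE Es sx nEx; have [t [ts _ Et teq]] := subspace_vspanP sE Es.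
exists t; split=> //; rewrite ltn_neqAle ts andbT; apply/eqP => /teq ts'.
by apply: nEx; exact: ts'.
Qed.

(** Cosemisimplicity as an induction principle. A nonzero subcoalgebra that is not simple contains a
    proper nonzero one, and both this and its orthogonal complement have smaller spanning lists. *)
Lemma subcoalgebra_ind b (P : set H) : posdef b ->
  right_invariant b -> left_invariant b -> subspace P ->
  (forall D, simple_subcoalgebra D -> forall x, D x -> P x) -> forall x, P x.
Proof.
move=> bp rb lb sP PD x; have [D [s [sD Dx Ds]]] := finite_subcoalgebra x bp.
have [n] := ubnP (size s).
elim: n => // n IHn in s D x sD Dx Ds *; rewrite ltnS => sn.
have [D0|nD0] := pselect (forall y, D y -> y = 0).
  by rewrite (D0 x Dx); case: sP.
have [simpD|nsimpD] := pselect (simple_subcoalgebra D); first exact: PD Dx.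
have [E [sE ED [e Ee e0] [d Dd nEd]]] : exists E : set H, [/\ subcoalgebra E,
    forall y, E y -> D y, exists2 e, E e & e <> 0 & exists2 d, D d & ~ E d].
  apply: contrapT => nE; apply: nsimpD; split=> //.
    by move=> D0; apply: nD0 => y; rewrite D0.
  move=> E sE ED; have [E0|nE0] := pselect (forall y, E y -> y = 0).
    left; apply/seteqP; split=> y; first by move=> /E0.
    by move=> ->; case: sE.
  right; apply/seteqP; split=> // d Dd; apply: contrapT => nEd; apply: nE.
  exists E; split=> //; last by exists d.
  apply: contrapT => nE'; apply: nE0 => y Ey; apply: contrapT => y0.
  by apply: nE'; exists y.
have spD := subcoalgebra_subspace sD; have spE := subcoalgebra_subspace sE.
have sF : subcoalgebra (perp b D E) by exact: (perp_subcoalgebra bp rb lb sD Ds).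
have PE y : E y -> P y.
  move=> Ey; have [t [ts Et]] := subspace_smaller spE
    (fun y Ey => Ds y (ED y Ey)) (Ds d Dd) nEd.
  by apply: (IHn t E) => //; exact: leq_trans ts sn.
have PF y : perp b D E y -> P y.
  move=> Fy; have [t [ts Ft]] := subspace_smaller (subcoalgebra_subspace sF)
    (fun y Fy => Ds y (proj1 Fy)) (Ds e (ED e Ee))
    (fun Fe => e0 (posdef_eq0 bp (proj2 Fe e Ee))).
  by apply: (IHn t (perp b D E)) => //; exact: leq_trans ts sn.
have [y [Ey Fy]] := perp_split bp spD Ds spE ED Dx.
by rewrite -(subrK y x); apply: subspaceD => //; [exact: PF|exact: PE].
Qed.

Section InvariantForms.
Variable a : hform H.
Hypotheses (ap : posdef a) (ra : right_invariant a).

Lemma twist_scalar z : scalar (fun x => a (T x) (T z)).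
Proof. by move=> k x y; rewrite skew_antipodeD skew_antipodeZ hformDl hformZl. Qed.

Definition twist := HForm twist_scalar (fun x y => hformC a (T x) (T y)).

Lemma twist_posdef : posdef twist.
Proof.
move=> x x0; apply: ap; apply: contra x0 => /eqP Tx0; apply/eqP.
by rewrite -(skew_antipodeK x) Tx0 linear0.
Qed.

(** [T] reverses the coproduct and so exchanges right and left. Applying [S] afterwards turns [T u1]
    into [u1] and [circ (T v1)] into [S (S (circ v1))]. *)
Lemma twist_left_invariant : left_invariant twist.
Proof.
move=> u v; have := congr1 S (ra (T u) (T v)).
rewrite (sw_skew_antipode (f := fun c d => a c (T v) *: d)); last first.
  exact: hform_balanced.
rewrite (sw_skew_antipode (f := fun c d => a (T u) c *: circ d)); last first.
  exact: hform_balanced_circ.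
rewrite !linear_sum => E; apply: etrans (etrans E _); apply: eq_bigr => p _ /=.
  by rewrite linearZ /= skew_antipodeK.
by rewrite linearZ /= circ_skew_antipode.
Qed.

(** The first factor supplies the left invariance and the second the right one. *)
Definition biform := tform twist a.

Lemma biform_posdef : posdef biform.
Proof. by apply: tform_posdef => //; exact: twist_posdef. Qed.

Lemma biform_right_invariant : right_invariant biform.
Proof. exact: tform_right_invariant. Qed.

Lemma biform_left_invariant : left_invariant biform.
Proof. by apply: tform_left_invariant; exact: twist_left_invariant. Qed.

(* A functional that is invariant on one side kills every simple subcoalgebra
   [D] other than the scalars, since [x |-> f x *: 1] maps [D] into [D]. *)
Lemma invariant_simple (f : H -> K) D x : scalar f ->
  (forall x, \sum_(p <- sw x) f p.1 *: p.2 = (f x)%:A) \/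
  (forall x, \sum_(p <- sw x) f p.2 *: p.1 = (f x)%:A) ->
  simple_subcoalgebra D -> D <> range (fun k : K => k%:A) -> D x -> f x = 0.
Proof.
move=> fl finv [sD _ Dmin] Dneq Dx; apply/eqP/negPn/negP => fx0; apply: Dneq.
have D1 : D 1.
  have [E1 E2] := subcoalgebra_costable sD fl Dx.
  rewrite -[1](scale1r (1 : H)) -(mulVf fx0) -scalerA.
  apply: subspaceZ; first exact: subcoalgebra_subspace.
  by case: finv => Ef; [rewrite -Ef|rewrite -Ef].
pose E : set H := range (fun k : K => k%:A).
have sE : subcoalgebra E.
  split; first by exists 0; rewrite // scale0r.
    by move=> k _ _ [l _ <-] [m _ <-]; exists (k * l + m);
      rewrite // scalerDl scalerA.
  move=> _ [k _ <-]; exists [:: (k%:A, 1)]; last first.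
    by rewrite big_seq1 linearZ /= comul1 pureZl.
  move=> p; rewrite inE => /eqP-> /=; split; first by exists k.
  by exists 1; rewrite // scale1r.
have ED : (E `<=` D)%classic.
  by move=> _ [k _ <-]; apply: subspaceZ => //; exact: subcoalgebra_subspace.
have [E0|//] := Dmin E sE ED.
have : E 1 by exists 1; rewrite // scale1r.
by rewrite E0 => /eqP; rewrite oner_eq0.
Qed.

End InvariantForms.
End Semisimplicity.

(** * The integral *)

Section RegularForm.
Variables (K : numClosedFieldType) (H : circHopfType K).

Definition regular_comodule : comodule H H :=
  @Build_comodule K H H (@comul K H) (@comulA K H) (@counitr K H).

(** Compactness enters the proof here, through the regular comodule. *)
Lemma regular_form : compact_quantum_group H ->
  exists a : hform H, posdef a /\ right_invariant a.
Proof.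
move=> /(_ _ regular_comodule)[dot udot].
have ds z : scalar (dot^~ z) by move=> k x y; rewrite linearPl.
have dC x y : dot y x = (dot x y)^* by rewrite hermC expr0 mul1r.
by exists (HForm ds dC); split=> [x|]; [exact: neq0_dnorm_gt0|exact: udot].
Qed.

End RegularForm.

Section Integral.
Variables (K : numClosedFieldType) (H : circHopfType K) (phi : {scalar H}).
Local Notation S := (@antipode K H).
Local Notation T := (@skew_antipode K H).
Implicit Types (x y u v : H) (b : hform H).
Hypothesis hphi : normal_integral phi.
Variable a : hform H.
Hypotheses (ap : posdef a) (ra : right_invariant a).

Let phi_scalar : scalar phi. Proof. exact: linearP. Qed.

Lemma integral_unique (f : H -> K) : scalar f -> f 1 = 1 ->
  (forall x, \sum_(p <- sw x) f p.1 *: p.2 = (f x)%:A) \/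
  (forall x, \sum_(p <- sw x) f p.2 *: p.1 = (f x)%:A) ->
  phi =1 f.
Proof.
move=> fl f1 finv; have [phi1 phi0] := hphi.
apply: (subcoalgebra_ind (P := fun x => phi x = f x) (biform_posdef ap)
  (biform_right_invariant ra)
  (biform_left_invariant ra)).
  split=> [|k x y px py]; first by rewrite linear0 scalarf0.
  by rewrite linearP fl px py.
move=> D simD x Dx.
have [D1|nD1] := pselect (D = range (fun k : K => k%:A)).
  move: Dx; rewrite D1 => -[k _ <-].
  by rewrite linearZ /= phi1 scalarfZ // f1.
by rewrite (phi0 D simD nD1 x Dx) (invariant_simple fl finv simD nD1 Dx).
Qed.

Lemma integral_right x : \sum_(p <- sw x) phi p.1 *: p.2 = (phi x)%:A.
Proof.
(* Right invariance of [a] at [v = 1] makes this functional invariant. *)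
pose h x := a x 1 / a 1 1.
have h_scalar : scalar h.
  by move=> k u v; rewrite /h hformDl hformZl mulrDl mulrA.
have h_inv u : \sum_(p <- sw u) h p.1 *: p.2 = (h u)%:A.
  transitivity ((a 1 1)^-1 *: \sum_(p <- sw u) a p.1 1 *: p.2).
    rewrite scaler_sumr; apply: eq_bigr => p _.
    by rewrite scalerA mulrC.
  rewrite ra (sw1 (f := fun c d => a u c *: circ d)); last first.
    exact: hform_balanced_circ.
  by rewrite circ1 scalerA mulrC.
have h1 : h 1 = 1 by rewrite /h mulfV // gt_eqF // ap // oner_neq0.
have E := integral_unique h_scalar h1 (or_introl h_inv).
by rewrite E -h_inv; apply: eq_bigr => p _; rewrite E.
Qed.

Lemma integral_circ x : phi (circ x) = (phi x)^*.
Proof.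
pose h x := (phi (circ x))^*.
have h_scalar : scalar h.
  by move=> k u v; rewrite /h linearP linearP rmorphD rmorphM /= conjCK.
have h_inv u : \sum_(p <- sw u) h p.2 *: p.1 = (h u)%:A.
  apply: (can_inj (@circK K H)); rewrite linear_sum circZ circ1 conjCK.
  rewrite -integral_right (sw_circ (f := fun c d => phi c *: d)) /=.
    by apply: eq_bigr => p _; rewrite circZ conjCK.
  exact: scalar_balanced.
have h1 : h 1 = 1 by rewrite /h circ1 hphi.1 rmorph1.
by rewrite (integral_unique h_scalar h1 (or_intror h_inv) x) conjCK.
Qed.

Lemma integral_antipode x : phi (S x) = phi x.
Proof.
have h_scalar : scalar (fun x => phi (S x)).
  by move=> k u v; rewrite !linearP.
apply/esym; apply: (integral_unique h_scalar); first by rewrite antipode1 hphi.1.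
right=> u; apply: (can_inj (@antipodeK K H)).
rewrite linear_sum linearZ /= antipode1 -integral_right.
rewrite (sw_antipode (f := fun c d => phi c *: d)) //=.
  by apply: eq_bigr => p _; rewrite linearZ.
exact: scalar_balanced.
Qed.

Lemma integral_left x : \sum_(p <- sw x) phi p.2 *: p.1 = (phi x)%:A.
Proof.
apply: (can_inj (@antipodeK K H)).
rewrite linear_sum linearZ /= antipode1 -integral_antipode -integral_right.
rewrite (sw_antipode (f := fun c d => phi c *: d)) //=.
  by apply: eq_bigr => p _; rewrite linearZ /= integral_antipode.
exact: scalar_balanced.
Qed.

(** Both sides contract the sum of [phi (x1 y1) x2 y2 S y3]: on the left [y2 S y3] cancels, on the
    right [phi] is invariant at [x y1]. *)
Lemma integral_mull x y :
  \sum_(p <- sw x) phi (p.1 * y) *: p.2 = \sum_(q <- sw y) phi (x * q.1) *: S q.2.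
Proof.
transitivity (\sum_(q <- sw y) (\sum_(r <- sw (x * q.1)) phi r.1 *: r.2) * S q.2);
  last by apply: eq_bigr => q _; rewrite integral_right -scalerAl mul1r.
transitivity (\sum_(q <- sw y) \sum_(r <- sw q.1) \sum_(p <- sw x)
    phi (p.1 * r.1) *: (p.2 * r.2 * S q.2)); last first.
  apply: eq_bigr => q _; rewrite (sw_mul (f := fun c d => phi c *: d)).
    rewrite mulr_suml exchange_big; apply: eq_bigr => p _ /=.
    by rewrite mulr_suml; apply: eq_bigr => r _; rewrite scalerAl.
  exact: scalar_balanced.
rewrite (sw_coassoc (g := fun c d e =>
    \sum_(p <- sw x) phi (p.1 * c) *: (p.2 * d * S e))); last first.
  split=> w; split=> *; rewrite -?big_split; apply: eq_bigr => q _ /=; bal.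
transitivity (\sum_(q <- sw y) \sum_(p <- sw x)
    phi (p.1 * q.1) *: (p.2 * \sum_(r <- sw q.2) r.1 * S r.2)); last first.
  apply: eq_bigr => q _; rewrite exchange_big; apply: eq_bigr => p _ /=.
  rewrite mulr_sumr scaler_sumr; apply: eq_bigr => r _.
  by rewrite mulrA.
rewrite exchange_big; apply: eq_bigr => p _ /=.
rewrite -{1}(sw_counitr y) mulr_sumr linear_sum scaler_suml.
apply: eq_bigr => q _ /=; rewrite sw_antipoder -!scalerAr linearZ mulr1.
by rewrite scalerA mulrC.
Qed.

(** The same with the sum of [phi (x3 y2) S x1 x2 y1]. *)
Lemma integral_mulr x y :
  \sum_(q <- sw y) phi (x * q.2) *: q.1 = \sum_(p <- sw x) phi (p.2 * y) *: S p.1.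
Proof.
transitivity (\sum_(p <- sw x) S p.1 * (\sum_(r <- sw (p.2 * y)) phi r.2 *: r.1));
  last by apply: eq_bigr => p _; rewrite integral_left -scalerAr mulr1.
transitivity (\sum_(p <- sw x) \sum_(r <- sw p.2) \sum_(q <- sw y)
    phi (r.2 * q.2) *: (S p.1 * r.1 * q.1)); last first.
  apply: eq_bigr => p _; rewrite (sw_mul (f := fun c d => phi d *: c)).
    rewrite mulr_sumr; apply: eq_bigr => r _ /=.
    by rewrite mulr_sumr; apply: eq_bigr => q _; rewrite -scalerAr mulrA.
  exact: scalar_balancedr.
rewrite -(sw_coassoc (g := fun c d e =>
    \sum_(q <- sw y) phi (e * q.2) *: (S c * d * q.1))); last first.
  split=> w; split=> *; rewrite -?big_split; apply: eq_bigr => q _ /=; bal.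
transitivity (\sum_(p <- sw x) \sum_(q <- sw y)
    phi (p.2 * q.2) *: ((\sum_(r <- sw p.1) S r.1 * r.2) * q.1)); last first.
  apply: eq_bigr => p _; rewrite exchange_big; apply: eq_bigr => q _ /=.
  by rewrite mulr_suml scaler_sumr; apply: eq_bigr.
rewrite exchange_big; apply: eq_bigr => q _ /=.
rewrite -{1}(sw_counitl x) mulr_suml linear_sum scaler_suml.
apply: eq_bigr => p _ /=; rewrite sw_antipodel -!scalerAl linearZ mul1r.
by rewrite scalerA mulrC.
Qed.

Lemma idot_scalar v : scalar (fun u => integral_dot phi u v).
Proof.
by move=> k x y; rewrite /integral_dot mulrDr linearD -scalerAr linearZ.
Qed.

Lemma idotC u v : integral_dot phi v u = (integral_dot phi u v)^*.
Proof.
rewrite /integral_dot -integral_circ circM circ_antipode circK.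
by rewrite -[RHS]integral_antipode antipodeM skew_antipodeK.
Qed.

Definition idot := HForm idot_scalar idotC.

(** This is [integral_mull] at [S (circ v)] and [u], with one [S] removed: [S] and [circ] both
    reverse the coproduct, so together they keep the order of the legs of [v]. *)
Lemma idot_right_invariant : right_invariant idot.
Proof.
move=> u v; apply: (can_inj (@antipodeK K H)).
have := integral_mull (S (circ v)) u.
have bf : balanced (fun c d : H => phi (c * u) *: d).
  apply: (@scalar_balanced _ _ (fun c => phi (c * u))) => k x y.
  by rewrite mulrDl linearD -scalerAl linearZ.
rewrite (sw_antipode (f := fun c d => phi (c * u) *: d)) //.
rewrite (sw_circ (f := fun c d => phi (S d * u) *: S c)); last by bal.
rewrite !linear_sum /= => E; apply: etrans (etrans (esym E) _);
  apply: eq_bigr => p _.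
  by rewrite linearZ.
by rewrite linearZ.
Qed.

(** The [S] produced by [integral_mulr] meets the [S] built into the inner product; this is the
    origin of the twist by [S \o S]. *)
Lemma idot_left_invariant : left_invariant idot.
Proof.
move=> u v; rewrite [LHS]integral_mulr.
rewrite (sw_antipode (f := fun c d => phi (d * u) *: S c)); last by bal.
by rewrite (sw_circ (f := fun c d => phi (S c * u) *: S (S d))); last by bal.
Qed.

(** Invariance of [b] replaces [u2] by [circ v2]; in the remaining [phi (S (circ v3) * circ v2)] the
    antipode cancels and leaves the counit. *)
Lemma tform_idot b u v : right_invariant b -> tform b idot u v = b u v.
Proof.
move=> rb.
transitivity (\sum_(q <- sw v) \sum_(r <- sw q.1)
    b u r.1 * idot (circ r.2) q.2).
  rewrite [LHS]exchange_big; apply: eq_bigr => q _ /=.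
  transitivity (idot (\sum_(p <- sw u) b p.1 q.1 *: p.2) q.2).
    by rewrite hform_suml; apply: eq_bigr => p _; rewrite hformZl.
  by rewrite rb hform_suml; apply: eq_bigr => r _; rewrite hformZl.
rewrite (sw_coassoc (g := fun c d e => b u c * idot (circ d) e)); last first.
  split=> w; split=> *;
    rewrite ?linearD ?hformDl ?hformDr ?mulrDr ?mulrDl //.
    by rewrite circZ hformZl hformZr mulrCA mulrA.
  by rewrite circZ hformZl hformZr.
rewrite -[in RHS](sw_counitr v) hform_sumr; apply: eq_bigr => q _.
rewrite hformZr -counit_circ -mulr_sumr mulrC; congr (_ * _).
transitivity (phi (\sum_(r <- sw (circ q.2)) S r.1 * r.2)).
  rewrite (sw_circ (f := fun c d => S c * d)); last by bal.
  by rewrite linear_sum.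
by rewrite sw_antipodel linearZ /= hphi.1 mulr1.
Qed.

End Integral.

(** * Positivity of the inner product *)

Section Pencil.
Variables (K : numClosedFieldType) (V : lmodType K).
Implicit Types (b d : hform V).

Lemma orthoseq_nth d (e : seq V) (i j : 'I_(size e)) : orthoseq d e ->
  i != j -> d e`_i e`_j = 0.
Proof.
move=> [/(pairwiseP 0) oe _].
rewrite -val_eqE neq_ltn => /orP[]ij; first by apply/eqP/oe => //; exact: ltn_ord.
by apply: hform_eq0C; apply/eqP/oe => //; exact: ltn_ord.
Qed.

(** An eigenvector of [b] relative to [d] exists because [K] is algebraically closed; its eigenvalue
    [b x x / d x x] is real because both forms are hermitian. *)
Lemma hform_pencil b d (e : seq V) : posdef d -> orthoseq d e -> e != [::] ->
  exists l x, [/\ vspan e x, x != 0, l \is Num.real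
    & forall y, vspan e y -> b x y = l * d x y].
Proof.
move=> dp oe e0; set n := size e.
have dn (i : 'I_n) : d e`_i e`_i != 0.
  rewrite gt_eqF // dp //; case: oe => _ /allP; apply; exact: mem_nth.
(* The columns are divided by [d e_j e_j] because [e] is orthogonal but not normalized. *)
pose M : 'M[K]_n := \matrix_(i, j) (b e`_i e`_j / d e`_j e`_j).
have [l] : exists l, root (char_poly M) l.
  apply/closed_rootP; rewrite size_char_poly eqSS /n.
  by case: (e) e0.
rewrite -eigenvalue_root_char => /eigenvalueP[r rM r0].
pose x := \sum_(i < n) r 0 i *: e`_i.
have dx (j : 'I_n) : d x e`_j = r 0 j * d e`_j e`_j.
  rewrite hform_suml (bigD1 j) //= hformZl big1 ?addr0 // => i ij.
  by rewrite hformZl orthoseq_nth // mulr0.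
have bx (j : 'I_n) : b x e`_j = l * d x e`_j.
  rewrite dx mulrA; have /matrixP/(_ 0 j) := rM; rewrite !mxE => <-.
  rewrite hform_suml mulr_suml; apply: eq_bigr => i _.
  by rewrite hformZl !mxE mulrA divfK.
have xe : vspan e x.
  apply: subspace_sum => [|i _]; first exact: subspace_vspan.
  apply: subspaceZ; first exact: subspace_vspan.
  by apply: vspan_mem; exact: mem_nth.
have x0 : x != 0.
  apply: contra r0 => /eqP x0; apply/eqP/rowP => j; rewrite mxE.
  have := dx j; rewrite x0 hform0l => /esym/eqP.
  by rewrite mulf_eq0 (negPf (dn j)) orbF => /eqP.
have bxy y : vspan e y -> b x y = l * d x y.
  apply: (vspan_min (E := fun y => b x y = l * d x y)).
    split=> [|k u v bu bv]; first by rewrite !hform0r mulr0.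
    by rewrite !hformDr !hformZr bu bv mulrDr mulrCA.
  move=> w we; have wi : (index w e < n)%N by rewrite index_mem.
  by have := bx (Ordinal wi); rewrite /= nth_index.
exists l, x; split=> //.
have -> : l = b x x / d x x by rewrite bxy // mulfK // gt_eqF // dp.
by rewrite realM ?realV //; apply/CrealP; rewrite -hformC.
Qed.

End Pencil.

Section Positivity.
Variables (K : numClosedFieldType) (H : circHopfType K) (phi : {scalar H}).
Hypothesis hphi : normal_integral phi.
Variable a : hform H.
Hypotheses (ap : posdef a) (ra : right_invariant a).
Local Notation beta := (idot hphi ap ra).
Implicit Types (b d : hform H).

Section Combination.
Variables (b d : hform H) (l : K).
Hypothesis lr : l \is Num.real.

Lemma hform_comb_scalar z : scalar (fun x => b x z - l * d x z).
Proof.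
move=> k x y; rewrite !hformDl !hformZl mulrDr opprD addrACA mulrBr.
by rewrite (mulrCA l).
Qed.

Lemma hform_combC x y : b y x - l * d y x = (b x y - l * d x y)^*.
Proof.
by rewrite rmorphB rmorphM /= -!hformC (CrealP lr).
Qed.

(** On a subcoalgebra [D], the eigenspace of [b] relative to [d] for [l] is the part of [D]
    orthogonal to [D] under this form. *)
Definition hform_comb := HForm hform_comb_scalar hform_combC.

Lemma hform_comb_right_invariant :
  right_invariant b -> right_invariant d -> right_invariant hform_comb.
Proof.
move=> rb rd u v; under eq_bigr do rewrite scalerBl -scalerA.
under [RHS]eq_bigr do rewrite scalerBl -scalerA.
by rewrite !sumrB -!scaler_sumr rb rd.
Qed.

Lemma hform_comb_left_invariant :
  left_invariant b -> left_invariant d -> left_invariant hform_comb.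
Proof.
move=> lb ld u v; under eq_bigr do rewrite scalerBl -scalerA.
under [RHS]eq_bigr do rewrite scalerBl -scalerA.
by rewrite !sumrB -!scaler_sumr lb ld.
Qed.

End Combination.

(* A subcoalgebra [D] is split as [E + F], where [E] is an eigenspace of the form
   relative to [d] and [F] its complement, which is treated by induction. *)
Lemma idot_posdef : posdef beta.
Proof.
move=> x; pose d := biform a.
have dp : posdef d by exact: biform_posdef.
have rd : right_invariant d by exact: biform_right_invariant.
have ld : left_invariant d by exact: biform_left_invariant.
have [D [s [sD Dx Ds]]] := finite_subcoalgebra x ap.
have [n] := ubnP (size s).
elim: n => // n IHn in s D x sD Dx Ds *; rewrite ltnS => sn x0.
have spD := subcoalgebra_subspace sD.
have [e [oe eD De]] := orthoseq_subspace dp spD Ds.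
have e0 : e != [::].
  by apply: contra x0 => /eqP e0; move: (De x Dx); rewrite e0 /= => ->.
have eD' y : vspan e y -> D y by exact: vspan_min.
have [l [z [ez z0 lr bz]]] := hform_pencil beta dp oe e0.
pose c := hform_comb beta d lr.
have rc : right_invariant c.
  by apply: hform_comb_right_invariant => //; exact: idot_right_invariant.
have lc : left_invariant c.
  by apply: hform_comb_left_invariant => //; exact: idot_left_invariant.
have sE : subcoalgebra (perp c D D) by exact: (perp_subcoalgebra dp rc lc sD Ds).
have Ez : perp c D D z.
  by split=> [|y /De/bz byz]; [exact: eD'|apply/eqP; rewrite subr_eq0; exact/eqP].
have bE y w : perp c D D y -> D w -> beta y w = l * d y w.
  by move=> [_ yc] /yc/eqP; rewrite subr_eq0 => /eqP.
(* The legs of [comul z] lie in the eigenspace, where [beta] is [l d]. So [l * tform a d z z] equals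
   [tform a beta z z], which is [a z z] by [tform_idot]. *)
have l_gt0 : 0 < l.
  have tp := tform_posdef ap dp z0.
  rewrite -(pmulr_lgt0 _ tp).
  suff -> : l * tform a d z z = a z z by exact: ap.
  rewrite -(tform_idot hphi ap ra z z ra).
  have [_ _ /(_ z Ez)[t tE zt]] := sE.
  rewrite !(tform_seq _ _ zt) mulr_sumr big_seq [RHS]big_seq.
  apply: eq_bigr => p /tE[_ Ep]; rewrite mulr_sumr big_seq [RHS]big_seq.
  by apply: eq_bigr => q /tE[_ [Dq _]]; rewrite bE // mulrCA.
have sF := perp_subcoalgebra dp rd ld sD Ds sE.
have [y [Ey Fxy]] := perp_split dp spD Ds (subcoalgebra_subspace sE)
  (fun y (Ey : perp c D D y) => proj1 Ey) Dx.
have byf : beta y (x - y) = 0.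
  by rewrite bE ?(hform_eq0C (Fxy.2 y Ey)) ?mulr0 //; case: Fxy.
have -> : beta x x = l * d y y + beta (x - y) (x - y).
  rewrite -bE //; last by case: Ey.
  have : x = x - y + y by rewrite subrK.
  move: (x - y) byf => w yw ->; rewrite hformDl !hformDr yw (hform_eq0C yw).
  by rewrite addr0 add0r addrC.
have ly : 0 <= l * d y y by rewrite mulr_ge0 ?(ltW l_gt0) // posdef_ge0.
have [xy|xy] := eqVneq (x - y) 0.
  rewrite xy hform0l addr0 mulr_gt0 // dp //.
  by move: x0; rewrite -(subrK y x) xy add0r.
apply: ltr_wpDl => //.
have [t [ts Ft]] := subspace_smaller (subcoalgebra_subspace sF)
  (fun y Fy => Ds y (proj1 Fy)) (Ds z (eD' z ez))
  (fun Fz => elimN eqP z0 (posdef_eq0 dp (proj2 Fz z Ez))).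
by apply: (IHn t (perp d D (perp c D D))) => //; exact: leq_trans ts sn.
Qed.

(* For [y = L x - x] the sum of the [<L^k y, y>], [k < m], is [0], and its terms
   are nonnegative, including [<y, y>] for [k = 0]. *)
Lemma positive_iter_id (L : H -> H) m : (forall x y, L (x - y) = L x - L y) ->
  positive_operator beta L -> (0 < m)%N -> iter m L =1 id -> L =1 id.
Proof.
move=> LB [Ls Lp] m0 Lm x; apply/eqP; rewrite -subr_eq0; apply/eqP.
set y := L x - x.
have L_iter j u v : beta (iter j L u) v = beta u (iter j L v).
  by elim: j v => // j IHj v; rewrite iterS Ls IHj -iterSr.
(* Half of the iterates move to the right argument: the value is [<w, w>] or [<L w, w>], according
   to the parity of [k]. *)
have ge0 k : 0 <= beta (iter k L y) y.
  rewrite -(odd_double_half k) addnC -addnn -addnA iterD L_iter.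
  case: (odd k); rewrite ?addn0 ?addn1 ?iterS; move: (iter _ L y) => w.
    by have [->|/Lp/ltW//] := eqVneq w 0; rewrite hform0r.
  by apply: posdef_ge0; exact: idot_posdef.
have : \sum_(0 <= k < m) beta (iter k L y) y = 0.
  transitivity (beta (\sum_(0 <= k < m) (iter k.+1 L x - iter k L x)) y).
    rewrite hform_suml; apply: eq_bigr => k _; congr (hform_fun _ _ _).
    by rewrite iterSr; elim: k => //= k ->; exact: LB.
  by rewrite telescope_sumr // Lm subrr hform0l.
case: m m0 {Lm} => // m _; rewrite big_nat_recl // => /eqP.
rewrite paddr_eq0; [|exact: (ge0 0%N)|by apply: sumr_ge0 => k _; exact: (ge0 k.+1)].
by move=> /andP[/eqP/(posdef_eq0 idot_posdef)].
Qed.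

End Positivity.

(** * The equivalences *)

Section Involutivity.
Variables (K : numClosedFieldType) (H : circHopfType K) (phi : {scalar H}).
Hypothesis hphi : normal_integral phi.
Variable a : hform H.
Hypotheses (ap : posdef a) (ra : right_invariant a).
Local Notation beta := (idot hphi ap ra).
Local Notation S := (@antipode K H).
Local Notation T := (@skew_antipode K H).
Implicit Types (x y u v : H).

Lemma integral_nondegenerate z : (forall c, phi (c * z) = 0) -> z = 0.
Proof. by move=> z0; apply: (posdef_eq0 (idot_posdef hphi ap ra)); exact: z0. Qed.

(** Nondegeneracy removes [phi (c * _)] from the first legs once the second legs are paired with a
    fixed [w]; the counit is then applied to what vanishes. *)
Lemma integral_cancel (s : seq (H * H)) :
  (forall c, \sum_(p <- s) phi (c * p.1) *: p.2 = 0) ->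
  \sum_(p <- s) counit p.1 *: p.2 = 0.
Proof.
move=> s0; apply: (posdef_ext (idot_posdef hphi ap ra)) => w.
rewrite hform0l hform_suml.
have : \sum_(p <- s) beta p.2 w *: p.1 = 0.
  apply: integral_nondegenerate => c; rewrite mulr_sumr linear_sum.
  transitivity (beta (\sum_(p <- s) phi (c * p.1) *: p.2) w); last first.
    by rewrite s0 hform0l.
  rewrite hform_suml; apply: eq_bigr => p _.
  by rewrite -scalerAr linearZ hformZl /= mulrC.
move=> /(congr1 counit); rewrite linear_sum linear0 => E.
by apply: etrans E; apply: eq_bigr => p _; rewrite hformZl linearZ /= mulrC.
Qed.

Lemma involutive_central :
  (forall x, S (S x) = x) -> forall x y, phi (x * y) = phi (y * x).
Proof.
move=> SS.
have TS z : T z = S z by rewrite -[z in LHS]SS antipodeK.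
suff key u v : phi (S (circ v) * u) = phi (u * S (circ v)).
  move=> x y; have -> : y = S (circ (circ (T y))) by rewrite circK skew_antipodeK.
  by rewrite key.
(* Here [S^2 = id] enters: as [S = T], the antipode also cancels against legs in reversed order. *)
have coL z : \sum_(r <- sw z) S (circ r.1) * circ r.2 = (counit (circ z))%:A.
  rewrite -sw_skew_antipodel (sw_circ (f := fun c d => T d * c)).
    by apply: eq_bigr => p _; rewrite TS.
  by split=> *; rewrite !TS ?linearD ?mulrDl ?mulrDr // linearZ -scalerAl -scalerAr.
have coR z : \sum_(r <- sw z) circ r.1 * S (circ r.2) = (counit (circ z))%:A.
  rewrite -sw_skew_antipoder (sw_circ (f := fun c d => d * T c)).
    by apply: eq_bigr => p _; rewrite TS.
  by split=> *; rewrite !TS ?linearD ?mulrDl ?mulrDr // linearZ -scalerAl -scalerAr.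
transitivity (\sum_(p <- sw u) \sum_(q <- sw v)
    beta p.1 q.1 * phi (p.2 * S (circ q.2))).
  (* Evaluation by right invariance: [u2] becomes [circ v2], which cancels against [S (circ v3)] by
     [coR]. *)
  transitivity (\sum_(q <- sw v) \sum_(r <- sw q.1)
      beta u r.1 * phi (circ r.2 * S (circ q.2))); last first.
    rewrite exchange_big; apply: eq_bigr => q _ /=.
    transitivity (phi ((\sum_(p <- sw u) beta p.1 q.1 *: p.2) * S (circ q.2))).
      rewrite (idot_right_invariant hphi ap ra) mulr_suml linear_sum.
      by apply: eq_bigr => r _; rewrite -scalerAl linearZ.
    rewrite mulr_suml linear_sum; apply: eq_bigr => p _.
    by rewrite -scalerAl linearZ.
  rewrite (sw_coassoc (g := fun c d e => beta u c * phi (circ d * S (circ e)))).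
    transitivity (beta u v) => //.
    rewrite -[in LHS](sw_counitr v) hform_sumr; apply: eq_bigr => q _.
    rewrite hformZr -counit_circ -mulr_sumr mulrC; congr (_ * _).
    by rewrite -linear_sum /= coR linearZ /= hphi.1 mulr1.
  split=> w; split=> *;
    rewrite ?hformDr ?linearD ?mulrDl ?mulrDr ?linearD ?mulrDr //.
    by rewrite hformZr circZ -scalerAl linearZ /= mulrCA mulrA.
  by rewrite !circZ linearZ -scalerAl -scalerAr !linearZ.
have linv q : \sum_(p <- sw u) phi (p.2 * S (circ q)) *: p.1 =
    \sum_(r <- sw q) phi (u * S (circ r.2)) *: circ r.1.
  apply: (can_inj (@antipodeK K H)); rewrite !linear_sum /=.
  transitivity (\sum_(p <- sw u) phi (p.2 * S (circ q)) *: S p.1).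
    by apply: eq_bigr => p _; rewrite linearZ.
  rewrite -(integral_mulr hphi ap ra).
  rewrite (sw_antipode (f := fun c d => phi (u * d) *: c)); last by bal.
  rewrite (sw_circ (f := fun c d => phi (u * S c) *: S d)); last by bal.
  by apply: eq_bigr => p _; rewrite linearZ.
(* Evaluation by left invariance: [linv] replaces [u1] by [circ v2], which cancels against
   [S (circ v1)] by [coL]. *)
transitivity (\sum_(q <- sw v) \sum_(r <- sw q.2)
    phi (S (circ q.1) * circ r.1) * phi (u * S (circ r.2))).
  rewrite exchange_big; apply: eq_bigr => q _ /=.
  transitivity (phi (S (circ q.1) *
      \sum_(p <- sw u) phi (p.2 * S (circ q.2)) *: p.1)).
    rewrite mulr_sumr linear_sum; apply: eq_bigr => p _.
    by rewrite -scalerAr linearZ mulrC.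
  rewrite linv mulr_sumr linear_sum; apply: eq_bigr => p _.
  by rewrite -scalerAr linearZ mulrC.
rewrite -(sw_coassoc (g := fun c d e =>
    phi (S (circ c) * circ d) * phi (u * S (circ e)))).
  rewrite -[in RHS](sw_counitl v) !linear_sum mulr_sumr linear_sum.
  apply: eq_bigr => q _ /=; rewrite -mulr_suml circZ linearZ /= -scalerAr linearZ /=.
  rewrite -counit_circ; congr (_ * _).
  by rewrite -linear_sum /= coL linearZ /= hphi.1 mulr1.
split=> w; split=> *; rewrite ?linearD ?mulrDl ?mulrDr ?linearD ?mulrDl ?mulrDr //.
  by rewrite !circZ linearZ -scalerAl -scalerAr !linearZ.
by rewrite !circZ linearZ -!scalerAr !linearZ /= mulrCA mulrA.
Qed.

(** Two uses of [integral_mull], with factors swapped under [phi] between them, give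
    [phi (c x1) x2 = phi (c x1) S (S x2)]; then [integral_cancel] removes [phi]. *)
Lemma central_involutive :
  (forall x y, phi (x * y) = phi (y * x)) -> forall x, S (S x) = x.
Proof.
move=> pC x; apply/esym; apply: subr0_eq.
transitivity (\sum_(p <- [seq (p.1, p.2 - S (S p.2)) | p <- sw x])
    counit p.1 *: p.2); last first.
  apply: integral_cancel => c; rewrite big_map /=.
  under eq_bigr do rewrite scalerBr.
  apply/eqP; rewrite sumrB subr_eq0; apply/eqP.
  transitivity (\sum_(p <- sw x) phi (p.1 * c) *: p.2).
    by apply: eq_bigr => p _; rewrite pC.
  rewrite (integral_mull hphi ap ra).
  transitivity (S (\sum_(q <- sw c) phi (q.1 * x) *: q.2)).
    by rewrite linear_sum; apply: eq_bigr => q _; rewrite linearZ /= pC.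
  rewrite (integral_mull hphi ap ra) linear_sum; apply: eq_bigr => p _.
  by rewrite linearZ.
rewrite big_map /=; under eq_bigr do rewrite scalerBr.
rewrite sumrB sw_counitl; congr (_ - _).
rewrite -[in LHS](sw_counitl x) !linear_sum; apply: eq_bigr => p _ /=.
by rewrite !linearZ.
Qed.

End Involutivity.

(** * Reduction of the operator conditions to centrality of the integral *)

Section Equivalences.
Variables (K : numClosedFieldType) (H : circHopfType K) (phi : {scalar H}).
Hypotheses (hH : compact_quantum_group H) (hphi : normal_integral phi).
Variables Sp N P : alg_automorphism H.
Hypotheses (hSp : positive_antipode phi Sp) (hN : nakayama phi N)
  (hP : positive_sqrt phi N P).
Local Notation S := (@antipode K H).
Local Notation T := (@skew_antipode K H).
Local Notation dot := (integral_dot phi).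
Implicit Types (x y : H).

Lemma integral_eq y z : (forall c, phi (c * y) = phi (c * z)) -> y = z.
Proof.
move=> yz; have [a [ap ra]] := regular_form hH; apply: subr0_eq.
apply: (integral_nondegenerate hphi ap ra) => c.
by rewrite mulrBr linearB yz subrr.
Qed.

Lemma positive_id (L : alg_automorphism H) m :
  positive_operator dot L -> (0 < m)%N -> iter m L =1 id -> L =1 id.
Proof.
have [a [ap ra]] := regular_form hH.
move=> Lp m0 Lm; apply: (@positive_iter_id _ _ _ hphi a ap ra L m) => //.
by move=> x y; rewrite linearB.
Qed.

Lemma cqg_integral_antipode x : phi (S x) = phi x.
Proof.
by have [a [ap ra]] := regular_form hH; exact: (integral_antipode hphi ap ra).
Qed.

Lemma dot_antipodel x y : dot (S x) y = phi (x * circ y).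
Proof. by rewrite /integral_dot -antipodeM cqg_integral_antipode. Qed.

Lemma dot_antipoder x y : dot x (S y) = phi (circ y * x).
Proof. by rewrite /integral_dot antipode_circ_antipode. Qed.

Lemma involutive_iff_central :
  S \o S =1 id <-> forall x y, phi (x * y) = phi (y * x).
Proof.
have [a [ap ra]] := regular_form hH; split=> [SS|pC x].
  exact: (involutive_central hphi ap ra).
exact: (central_involutive hphi ap ra).
Qed.

Lemma nakayama_iff_central : N =1 id <-> forall x y, phi (x * y) = phi (y * x).
Proof.
split=> [N1 x y|pC x]; first by rewrite hN N1.
by apply: integral_eq => c; rewrite -hN pC.
Qed.

Lemma selfadjoint_iff_central :
  selfadjoint dot S <-> forall x y, phi (x * y) = phi (y * x).
Proof.
split=> [Ss x y|pC x y]; last by rewrite dot_antipodel dot_antipoder pC.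
by have := Ss x (circ y); rewrite dot_antipodel dot_antipoder !circK.
Qed.

(** Positivity is available for [P], whose iterate of order [2 m] is the iterate of order [m] of
    [N]; so [P] is the identity, and [N] with it. *)
Lemma nakayama_sqrt m : (0 < m)%N -> iter m N =1 id -> N =1 id /\ P =1 id.
Proof.
move=> m0 Nm; have [Pp PP] := hP.
have P1 : P =1 id.
  apply: (@positive_id _ m.*2) => //; first by rewrite double_gt0.
  move=> x; rewrite -[RHS](Nm x); elim: m {m0 Nm} => //= m ->.
  by rewrite -(PP _).
by split=> // x; rewrite -PP /= !P1.
Qed.

Lemma positive_antipode_involutive : Sp =1 id <-> S \o S =1 id.
Proof.
have [_ Sp_pos SpS] := hSp; split=> [S1 x|SS]; first by rewrite -SpS /= !S1.
by apply: (@positive_id _ 2) => // x; rewrite -[RHS]SS -SpS.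
Qed.

(** If [S^n = id], then the iterate of [Sp] of order [2 n] is [S^(2 n) = id], and [Sp] is
    positive. *)
Lemma finite_order_involutive : finite_order S -> S \o S =1 id.
Proof.
move=> [n n0 Sn]; apply/positive_antipode_involutive.
have [_ Sp_pos SpS] := hSp; apply: (@positive_id _ n.*2) => //.
  by rewrite double_gt0.
move=> x; rewrite -[RHS](Sn x) -[X in _ = iter n S X](Sn x) -iterD addnn.
elim: n {n0 Sn} => // n IHn; rewrite doubleS !iterS IHn.
exact: (SpS _).
Qed.

(* With [M] the adjoint of [S], evaluating the equal forms [<x, S M y>] and
   [<x, M S y>] gives [phi (N (S x) * y°) = phi (y° * S x)], so [N^2 = 1]. *)
Lemma normal_nakayama : normal_operator dot S -> N =1 id.
Proof.
move=> [M adjM SM]; apply: (proj1 (@nakayama_sqrt 2 isT _)) => z.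
rewrite -(skew_antipodeK z); set x := T z; apply: integral_eq => c /=.
have adjE u v : phi (S (circ (M v)) * u) = phi (u * circ v).
  by rewrite -dot_antipodel adjM.
pose y := circ c; have -> : c = circ y by rewrite circK.
have E : dot x (S (M y)) = dot x (M (S y)) by have /= -> := SM y.
rewrite -hN -adjE -hN -antipodeM cqg_integral_antipode -dot_antipoder E.
rewrite -adjM dot_antipodel.
by rewrite circ_antipode -cqg_integral_antipode antipodeM skew_antipodeK.
Qed.

(** From [N S^2 = id] one gets [phi (S^2 x * y) = phi (y * x)]. This swap between two uses of
    [integral_mulr] gives [phi (x2 d) S^4 x1 = phi (x2 d) x1], and [integral_cancel] yields order
    4. *)
Lemma unitary_antipode_order : unitary_antipode Sp P =1 S -> finite_order S.
Proof.
move=> US; have [a [ap ra]] := regular_form hH.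
have [_ _ SpS] := hSp; have [_ PP] := hP.
have PSp x : P (Sp x) = x.
  have /= /(can_inj (@antipodeK K H)) E := US (P (Sp x)).
  by move: E; rewrite !autK => <-.
have NSS x : N (S (S x)) = x.
  have /= <- := SpS x; have /= <- := PP (Sp (Sp x)).
  by rewrite PSp PSp.
have pSS x y : phi (S (S x) * y) = phi (y * x) by rewrite hN NSS.
exists 4 => // x /=; apply: subr0_eq.
transitivity (\sum_(p <- [seq (S p.2, S (S (S (S p.1))) - p.1) | p <- sw x])
    counit p.1 *: p.2); last first.
  apply: (integral_cancel hphi ap ra) => c; rewrite big_map /=.
  under eq_bigr do rewrite scalerBr.
  apply/eqP; rewrite sumrB subr_eq0; apply/eqP.
  (* As [c = S d], invariance of [phi] under [S] brings [phi (c * S p)] to the form handled by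
     [integral_mulr]. *)
  pose d := T c; have phiS p : phi (c * S p) = phi (p * d).
    by rewrite -[c](skew_antipodeK c) -antipodeM cqg_integral_antipode.
  transitivity (S (S (S (\sum_(q <- sw d) phi (x * q.2) *: q.1)))).
    rewrite (integral_mulr hphi ap ra) !linear_sum; apply: eq_bigr => p _ /=.
    by rewrite !linearZ phiS.
  transitivity (\sum_(r <- sw (S (S d))) phi (r.2 * x) *: S r.1).
    rewrite (sw_antipode (f := fun u v => phi (v * x) *: S u)); last by bal.
    rewrite (sw_antipode (f := fun u v => phi (S u * x) *: S (S v))); last by bal.
    by rewrite !linear_sum; apply: eq_bigr => q _ /=; rewrite !linearZ pSS.
  rewrite -(integral_mulr hphi ap ra); apply: eq_bigr => p _.
  by rewrite pSS phiS.
rewrite big_map /=; under eq_bigr do rewrite scalerBr counit_antipode.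
rewrite sumrB sw_counitr; congr (_ - _).
rewrite -[in LHS](sw_counitr x) !linear_sum; apply: eq_bigr => p _ /=.
by rewrite !linearZ.
Qed.

End Equivalences.

Theorem theorem8p15 (R : realType) (H : circHopfType R[i])
    (hH : compact_quantum_group H)
    (phi : {scalar H}) (hphi : normal_integral phi)
    (Sp N P : alg_automorphism H)
    (hSp : positive_antipode phi Sp)
    (hN : nakayama phi N)
    (hP : positive_sqrt phi N P) :
  [<-> antipode \o antipode =1 (id : H -> H);
       Sp =1 id;
       unitary_antipode Sp P =1 antipode;
       finite_order (antipode : H -> H);
       normal_operator (integral_dot phi) antipode;
       selfadjoint (integral_dot phi) antipode;
       forall x y : H, phi (x * y) = phi (y * x);
       N =1 id].
Proof.
have cen := involutive_iff_central hH hphi.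
have nak := nakayama_iff_central hH hphi hN.
have adj := selfadjoint_iff_central hH hphi.
have pos := positive_antipode_involutive hH hphi hSp.
tfae.
- by move/pos.
(* [Sp = id] gives centrality, hence [N = id] and [P = id]; both inverse factors of the unitary
   antipode are then trivial. *)
- move=> Sp1; have /nak N1 : forall x y, phi (x * y) = phi (y * x) by apply/cen/pos.
  have [_ P1] := @nakayama_sqrt _ _ _ hH hphi _ _ hP 1 isT N1.
  have inv1 (f : alg_automorphism H) : f =1 id -> aut_inv f =1 id.
    by move=> f1 x; rewrite -[x in LHS]f1 autK.
  by move=> x; rewrite /unitary_antipode /= !inv1.
- exact: (unitary_antipode_order hH hphi hSp hN hP).
- by move=> /(finite_order_involutive hH hphi hSp)/cen/adj Sadj; exists antipode.
- by move=> /(normal_nakayama hH hphi hN hP)/nak/adj.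
- by move/adj.
- by move/nak.
- by move/nak/cen.
Qed.
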